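(* For every $\gamma>0$ and every $k\in\mathbb{N}$ with $k\ge 2$, there exists a constant $\mu>0$ such that for all sufficiently large $n$, every $\left(n,\frac{k}{k+1}+\gamma,\mu\right)$-incompatibility system $(G,\mathcal{F})$ contains a compatible $k$-th power of a Hamilton cycle; that is, $G$ contains a subgraph which is the $k$-th power of a Hamilton cycle of $G$'s vertex set and which is compatible with respect to $\mathcal{F}$.
   Context: All graphs are finite and simple. An incompatibility system $\mathcal{F}$ over a graph $G=(V,E)$ is a family $\mathcal{F}=\{F_v\}_{v\in V}$ such that for every $v\in V$, $F_v$ is a family of unordered pairs $\{e,e'\}$ of distinct edges of $G$ with $e\cap e'=\{v\}$. Two edges $e,e'$ are incompatible (at $v$) if $\{e,e'\}\in F_v$ for some vertex $v$; otherwise they are compatible. A (not necessarily induced) subgraph $H\subseteq G$ is compatible if every pair of adjacent edges of $H$ is compatible. For $\Delta>0$, $\mathcal{F}$ is $\Delta$-bounded if for every vertex $v$ and every edge $e$ incident with $v$, there are at most $\Delta$ other edges incident with $v$ that are incompatible with $e$ at $v$. Given $\mu,\delta>0$ and $n\in\mathbb{N}$, an $(n,\delta,\mu)$-incompatibility system $(G,\mathcal{F})$ consists of an $n$-vertex graph $G$ with minimum degree $\delta(G)\ge\delta n$ and a $\mu n$-bounded incompatibility system $\mathcal{F}$ over $G$. The $k$-th power of a Hamilton cycle is the graph on the same vertex set whose edges join all pairs of distinct vertices at distance at most $k$ in the Hamilton cycle (where the cycle is a cyclic ordering of all $n$ vertices, and all these edges are required to be edges of $G$). *)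

(* Defs.v *)
From HB Require Import structures.
From mathcomp Require Import all_boot all_order all_algebra.
From mathcomp Require Import reals.

Set Implicit Arguments.
Unset Strict Implicit.
Unset Printing Implicit Defensive.
Import Order.TTheory GRing.Theory Num.Theory.
Local Open Scope ring_scope.

Record sgraph (V : finType) := SGraph {
  adj : rel V;
  adj_sym : symmetric adj;
  adj_irr : irreflexive adj
}.

Definition edges (V : finType) (G : sgraph V) : {set {set V}} :=
  [set [set p.1; p.2] | p in [set p : V * V | adj G p.1 p.2]].

Definition subgraph (V : finType) (H G : sgraph V) : Prop :=
  edges H \subset edges G.

Definition degree (V : finType) (G : sgraph V) (v : V) : nat :=
  #|[set w | adj G v w]|.

(* Every degree is below #|V|, so the starting value #|V| matters only when
   V is empty, where it gives 0. *)
Definition min_degree (V : finType) (G : sgraph V) : nat :=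
  \big[minn/#|V|]_(v : V) degree G v.

Record incompat_system (V : finType) (G : sgraph V) := IncompatSystem {
  incompat_at :> V -> {set {set {set V}}};
  incompat_atP : forall (v : V) (P : {set {set V}}), P \in incompat_at v ->
    exists e e' : {set V},
      [/\ e \in edges G, e' \in edges G, e != e', e :&: e' = [set v]
        & P = [set e; e']]
}.

Definition incompatible (V : finType) (G : sgraph V) (F : incompat_system G)
    (e e' : {set V}) : Prop :=
  exists v : V, [set e; e'] \in F v.

Definition compatible (V : finType) (G : sgraph V) (F : incompat_system G)
    (H : sgraph V) : Prop :=
  forall e e' : {set V}, e \in edges H -> e' \in edges H ->
    e != e' -> e :&: e' != set0 -> ~ incompatible F e e'.

Definition bounded_system (R : realType) (V : finType) (G : sgraph V)
    (F : incompat_system G) (Delta : R) : Prop :=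
  forall (v : V) (e : {set V}), e \in edges G -> v \in e ->
    #|[set e' in edges G | [&& v \in e', e' != e & [set e; e'] \in F v]]|%:R
      <= Delta.

Definition is_incompat_system (R : realType) (n : nat) (delta mu : R)
    (V : finType) (G : sgraph V) (F : incompat_system G) : Prop :=
  [/\ #|V| = n, delta * n%:R <= (min_degree G)%:R
    & bounded_system F (mu * n%:R)].

Definition is_hamilton_cycle (V : finType) (C : sgraph V) : Prop :=
  exists c : seq V,
    [/\ (2 < size c)%N, uniq c, (forall x : V, x \in c)
      & forall x y : V, adj C x y = (next c x == y) || (next c y == x)].

Definition dist_le (V : finType) (C : sgraph V) (k : nat) (x y : V) : Prop :=
  exists p : seq V,
    [/\ path (adj C) x p, last x p = y & (size p <= k)%N].

Definition is_power (V : finType) (k : nat) (C H : sgraph V) : Prop :=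
  forall x y : V, adj H x y <-> x != y /\ dist_le C k x y.

Definition is_hamilton_power (V : finType) (k : nat) (H : sgraph V) : Prop :=
  exists2 C : sgraph V, is_hamilton_cycle C & is_power k C H.

(* Main.v *)
(** The cycle is built greedily, without regularity or randomness.

    Only edges [uw] that are incompatible at few common centres are kept; this
    costs little minimum degree and makes every incompatibility condition a
    sparse one, so that any structure present in positive density also occurs
    injectively and compatibly.

    Connecting: any [k + 1] vertices have linearly many common neighbours, and
    one can walk from a clique to an ordered clique [r'_0, ..., r'_(k-1)] in [k]
    rounds of [k + 1] steps, each round making the free vertices adjacent to one
    more [r'_t] and then fixing it. The walk repeats vertices; its blow-up,
    which has positive density as well, contains genuine paths.

    Absorbing: choosing segments by averaging against the weights
    [2 ^ - (number of absorbers of v so far)] yields a short path in which every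
    vertex has linearly many absorbing segments.

    Covering: the path is extended by segments whose weight is at most average
    for the weights [w x = sum over the neighbours v of x of exp (lam (excess of v))];
    they exist because greedily choosing the lightest common neighbour gives a
    light [K_(k+1)]. This multiplicative-weights rule keeps the number of
    unused non-neighbours of every vertex proportional to the number of unused
    vertices, so the extension can go on until few vertices remain. The path is
    then closed up and absorbs the rest. *)

Require Import Defs.
From mathcomp Require Import all_boot all_order all_algebra.
From mathcomp Require Import boolp reals sequences exp.
From mathcomp Require Import ring lra zify.
Set Implicit Arguments.
Unset Strict Implicit.
Unset Printing Implicit Defensive.
Import Order.TTheory GRing.Theory Num.Theory.
Local Open Scope ring_scope.

(** * Averages over lists of vertices *)

Section Average.
Variables (R : realType) (V : finType).
Implicit Types (U : {set V}) (x : V) (s t : seq V) (m p a : nat) (f g : seq V -> R).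

Definition avg U (f : V -> R) : R := (\sum_(x in U) f x) / #|U|%:R.

(** The expectation of [f] at [m] independent uniform elements of [U], repetitions allowed. The
    iterated form turns independence and exchange of averages into inductions on [m]. *)
Fixpoint Em U m (f : seq V -> R) : R :=
  if m is m'.+1 then avg U (fun x => Em U m' (fun s => f (x :: s))) else f [::].

Variable U : {set V}.
Hypothesis U_gt0 : (0 < #|U|)%N.

Lemma cardU_gt0 : 0 < #|U|%:R :> R. Proof. by rewrite ltr0n. Qed.
Let U_neq0 : #|U|%:R != 0 :> R. Proof. by rewrite gt_eqF ?cardU_gt0. Qed.

Lemma avg_const c : avg U (fun=> c) = c.
Proof. by rewrite /avg sumr_const -[c *+ _]mulr_natr mulfK. Qed.

Lemma avg_le (f g : V -> R) : (forall x, x \in U -> f x <= g x) -> avg U f <= avg U g.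
Proof.
by move=> fg; apply: ler_wpM2r; [rewrite invr_ge0 ler0n | apply: ler_sum].
Qed.

Lemma eq_avg (f g : V -> R) : f =1 g -> avg U f = avg U g.
Proof. by move=> fg; rewrite /avg; congr (_ / _); apply: eq_bigr => x _. Qed.

Lemma avg_sum (I : Type) (r : seq I) (P : pred I) (F : I -> V -> R) :
  avg U (fun x => \sum_(i <- r | P i) F i x) = \sum_(i <- r | P i) avg U (F i).
Proof. by rewrite /avg exchange_big -mulr_suml. Qed.

Lemma avgZ c (f : V -> R) : avg U (fun x => c * f x) = c * avg U f.
Proof. by rewrite /avg -mulr_sumr mulrA. Qed.

Lemma avgD (f g : V -> R) : avg U (fun x => f x + g x) = avg U f + avg U g.
Proof. by rewrite /avg big_split mulrDl. Qed.

Lemma avg_card (P : pred V) : avg U (fun x => (P x)%:R) = #|[set x in U | P x]|%:R / #|U|%:R.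
Proof.
rewrite /avg -natr_sum; congr (_%:R / _).
rewrite -sum1_card [RHS]big_mkcond [LHS]big_mkcond /=.
by apply: eq_bigr => x _; rewrite inE; case: (x \in U); case: (P x).
Qed.

Lemma avg_exists c (f : V -> R) : c <= avg U f -> exists2 x, x \in U & c <= f x.
Proof.
move=> cf; apply: contrapT => nex.
have lt x : x \in U -> f x < c.
  by move=> xU; rewrite ltNge; apply/negP => ?; apply: nex; exists x.
have [x0 x0U] : exists x, x \in U by apply/card_gt0P.
suff : avg U f < c by rewrite ltNge cf.
rewrite /avg ltr_pdivrMr ?cardU_gt0 // mulr_natr -sumr_const.
rewrite (bigD1 x0) //= [ltRHS](bigD1 x0) //= ltr_leD ?lt //.
by apply: ler_sum => x /andP[xU _]; apply/ltW/lt.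
Qed.

Lemma eq_Em m f g : f =1 g -> Em U m f = Em U m g.
Proof. by elim: m f g => [|m IH] f g fg /=; rewrite ?fg //; apply: eq_avg => x; apply: IH. Qed.

Lemma Em_le m f g :
  (forall s, size s = m -> all (mem U) s -> f s <= g s) -> Em U m f <= Em U m g.
Proof.
elim: m f g => [|m IH] f g fg /=; first exact: fg.
by apply: avg_le => x xU; apply: IH => s ss sU; apply: fg; rewrite /= ?ss ?sU ?xU.
Qed.

Lemma Em_const m c : Em U m (fun=> c) = c.
Proof. by elim: m => //= m IH; rewrite (eq_avg (fun=> IH)) avg_const. Qed.

Lemma Em_sum m (I : Type) (r : seq I) (P : pred I) (F : I -> seq V -> R) :
  Em U m (fun s => \sum_(i <- r | P i) F i s) = \sum_(i <- r | P i) Em U m (F i).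
Proof. by elim: m F => //= m IH F; rewrite (eq_avg (fun=> IH _)) avg_sum. Qed.

Lemma EmZ m c f : Em U m (fun s => c * f s) = c * Em U m f.
Proof. by elim: m f => //= m IH f; rewrite (eq_avg (fun=> IH _)) avgZ. Qed.

Lemma EmD m f g : Em U m (fun s => f s + g s) = Em U m f + Em U m g.
Proof. by elim: m f g => //= m IH f g; rewrite (eq_avg (fun=> IH _ _)) avgD. Qed.

Lemma EmB m f g : Em U m (fun s => f s - g s) = Em U m f - Em U m g.
Proof.
rewrite EmD; congr (_ + _); rewrite -mulN1r -EmZ.
by apply: eq_Em => s; rewrite mulN1r.
Qed.

Lemma Em_avg m (F : V -> seq V -> R) :
  Em U m (fun s => avg U (F^~ s)) = avg U (fun x => Em U m (F x)).
Proof.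
rewrite /avg -Em_sum mulrC -EmZ; apply: eq_Em => s; rewrite mulrC //.
Qed.

Lemma Em_exch m p (F : seq V -> seq V -> R) :
  Em U m (fun s => Em U p (F s)) = Em U p (fun t => Em U m (F^~ t)).
Proof. by elim: m F => //= m IH F; rewrite (eq_avg (fun=> IH _)) Em_avg. Qed.

Lemma Em_cat m p f :
  Em U (m + p) f = Em U m (fun s => Em U p (fun t => f (s ++ t))).
Proof. by elim: m f => //= m IH f; apply: eq_avg => x; rewrite IH. Qed.

Lemma Em_exists m c f : c <= Em U m f ->
  exists s, [/\ size s = m, all (mem U) s & c <= f s].
Proof.
elim: m f => [|m IH] f /=; first by move=> cf; exists [::].
move=> /avg_exists[x xU /IH[s [ss sU cs]]].
by exists (x :: s); rewrite /= ss sU xU.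
Qed.

(** Averages commute, so coordinate [p] may be averaged first with the others frozen. This bounds
    events that are rare in one well-chosen variable. *)
Lemma Em_coord x0 m p f c : (p < m)%N ->
  (forall s, size s = m -> avg U (fun x => f (set_nth x0 s p x)) <= c) ->
  Em U m f <= c.
Proof.
have [u0 u0U] : exists x, x \in U by apply/card_gt0P.
elim: m p f => [//|m IH] [|p] f; last first.
  rewrite ltnS => pm fc /=; rewrite -[c]avg_const; apply: avg_le => x xU.
  by apply: (IH p) => // s ss; apply: (fc (x :: s)); rewrite /= ss.
move=> _ fc /=; rewrite -(Em_avg m (fun x s => f (x :: s))) -[c](Em_const m).
by apply: Em_le => s ss _; apply: (fc (x0 :: s)); rewrite /= ss.
Qed.

(* Pointwise [d (f - c/2) <= g], because [f <= 1]. *)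
Lemma reverse_markov m c d f g : 0 <= c -> 0 <= d -> c <= Em U m f ->
  (forall s, f s <= 1) -> (forall s, 0 <= g s) ->
  (forall s, c / 2 <= f s -> d <= g s) -> c / 2 * d <= Em U m g.
Proof.
move=> c0 d0 cf f1 g0 fg.
have : Em U m (fun s => d * (f s - c / 2)) <= Em U m g.
  apply: Em_le => s _ _; have [/fg dg|lt] := leP (c / 2) (f s).
    apply: le_trans dg; rewrite -[leRHS]mulr1 ler_wpM2l //.
    by have := f1 s; lra.
  by apply: le_trans (g0 s); rewrite mulr_ge0_le0 // subr_le0 ltW.
rewrite EmZ EmB Em_const; apply: le_trans.
by rewrite mulrC ler_wpM2l //; lra.
Qed.
End Average.

(** * Blow-ups and greedy choices *)

Section Blowup.
Variables (R : realType) (V : finType).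
Implicit Types (P Q : pred (seq V)).

Definition Pr (U : {set V}) m P : R := Em U m (fun s => (P s)%:R).

(* [bu a m P s]: cutting [s] into [m] blocks of length [a], every choice of one
   entry from each block satisfies [P]. *)
Fixpoint bu a m P (s : seq V) : bool :=
  if m is m'.+1 then all (fun x => bu a m' (fun t => P (x :: t)) (drop a s)) (take a s)
  else P [::].

(** Each level uses [reverse_markov] twice: [c1] bounds the density once the first coordinate is a
    block of length [a]; then a proportion [c1 / 2] of the blocks leaves density [c1 / 2] for the
    other coordinates. *)
Fixpoint bu_bound a m (c : R) : R :=
  if m is m'.+1 then
    let c1 := c / 2 * (c / 2) ^+ a in c1 / 2 * bu_bound a m' (c1 / 2)
  else c.

Lemma bu_bound_gt0 a m c : 0 < c -> 0 < bu_bound a m c.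
Proof.
elim: m c => //= m IH c c0.
have c20 : 0 < c / 2 by lra.
have : 0 < c / 2 * (c / 2) ^+ a by rewrite mulr_gt0 ?exprn_gt0.
by move=> c10; rewrite mulr_gt0 ?IH //; lra.
Qed.

Lemma bu_all a m (I : Type) (r : seq I) (F : I -> pred (seq V)) s :
  bu a m (fun t => all (F^~ t) r) s = all (fun i => bu a m (F i) s) r.
Proof.
elim: m F s => //= m IH F s.
under eq_all do rewrite IH.
clear IH; elim: (take a s) => [|x l IHl] /=; first by elim: r.
by rewrite IHl -all_predI.
Qed.

Lemma bu_transversal x0 a m P s (sigma : nat -> nat) :
  size s = (m * a)%N -> (forall i, (i < m)%N -> (sigma i < a)%N) -> bu a m P s ->
  P (mkseq (fun i => nth x0 s (i * a + sigma i)) m).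
Proof.
elim: m P s sigma => //= m IH P s sigma ss sig /allP H.
have s0 := sig 0 isT.
have /H/IH : nth x0 s (sigma 0) \in take a s.
  rewrite -(@nth_take a) //; apply: mem_nth; rewrite size_take_min ss.
  by rewrite leq_min s0; nia.
move=> /(_ (fun i => sigma i.+1)); rewrite size_drop ss mulSn addKn => /(_ erefl).
move=> /(_ (fun i im => sig i.+1 im)); congr (P (_ :: _)).
rewrite -/(map _ _) -/(iota 1 m) (iotaDl 1 0) -map_comp; apply: eq_map => i /=.
by rewrite nth_drop; congr nth; rewrite add1n; lia.
Qed.

Variable U : {set V}.
Hypothesis U_gt0 : (0 < #|U|)%N.

Lemma Pr_le m P Q : (forall s, size s = m -> all (mem U) s -> P s -> Q s) ->
  Pr U m P <= Pr U m Q.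
Proof.
move=> PQ; apply: Em_le => s ss sU; case Ps: (P s); last exact: ler0n.
by rewrite (PQ s).
Qed.

Lemma Pr_exists m P : 0 < Pr U m P -> exists s, [/\ size s = m, all (mem U) s & P s].
Proof.
move=> P0; have [s [ss sU +]] := Em_exists U_gt0 (lexx (Pr U m P)).
case Ps: (P s); first by exists s.
by rewrite leNgt P0.
Qed.

Lemma Em_all a (Q : pred V) :
  Em U a (fun s => (all Q s)%:R) = (avg U (fun x => (Q x)%:R)) ^+ a :> R.
Proof.
elim: a => [|a IH] //=; rewrite exprS -IH mulrC -avgZ; apply: eq_avg => x.
by rewrite mulrC -EmZ; apply: eq_Em => s; case: (Q x); rewrite ?mul1r ?mul0r.
Qed.

(** Induction on [m]. For fixed later coordinates, a whole block fits with the [a]-th power of the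
    probability of one entry, which stays bounded below on average. A good block [xs] then makes
    [PP xs] a dense predicate on the remaining coordinates. *)
Lemma Pr_blowup a m c P : 0 < c -> c <= Pr U m P -> bu_bound a m c <= Pr U (m * a) (bu a m P).
Proof.
elim: m c P => [|m IH] c P c0 cP //=.
have c20 : 0 < c / 2 by lra.
pose PP xs t := all (fun x => P (x :: t)) xs.
set c1 := _ * _ ^+ _.
have c10 : 0 < c1 by rewrite mulr_gt0 ?exprn_gt0.
have E1 : c1 <= Em U a (fun xs => Pr U m (PP xs)).
  rewrite /Pr Em_exch.
  have : c <= Em U m (fun t => avg U (fun x => (P (x :: t))%:R)).
    by rewrite (Em_avg U m (fun x t => (P (x :: t))%:R)).
  move=> /(@reverse_markov _ _ _ U_gt0 _ _ ((c / 2) ^+ a)); apply.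
  - exact: ltW.
  - by rewrite exprn_ge0 // ltW.
  - move=> s; rewrite -[leRHS](avg_const U_gt0); apply: avg_le => x _.
    by case: (P _); rewrite ?lexx ?ler01.
  - by move=> s; rewrite -[leLHS](Em_const U_gt0 a); apply: Em_le.
  - by move=> s cs; rewrite Em_all lerXn2r // nnegrE ?ltW //; apply: lt_le_trans cs.
have -> : Pr U (m.+1 * a) (bu a m.+1 P) =
    Em U a (fun xs => Pr U (m * a) (bu a m (PP xs))).
  rewrite mulSn /Pr Em_cat; apply: le_anti; apply/andP; split.
    apply: Em_le => s ss _; apply: Em_le => t _ _ /=.
    by rewrite take_size_cat // drop_size_cat // /PP (bu_all a m s (fun x t => P (x :: t))).
  apply: Em_le => s ss _; apply: Em_le => t _ _ /=.
  by rewrite take_size_cat // drop_size_cat // /PP (bu_all a m s (fun x t => P (x :: t))).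
have c120 : 0 < c1 / 2 by lra.
apply: (reverse_markov U_gt0 _ _ E1).
- exact: ltW.
- by apply/ltW/bu_bound_gt0.
- move=> s; rewrite -[leRHS](Em_const U_gt0 m); apply: Em_le => t _ _.
  by case: (PP _ _); rewrite ?lexx ?ler01.
- by move=> s; rewrite -[leLHS](Em_const U_gt0 (m * a)); apply: Em_le.
- by move=> s; apply: IH.
Qed.

(** [pre] holds the roots followed by the entries already read, so that a condition may refer to
    both. *)
Fixpoint chain (C : seq V -> pred V) pre (s : seq V) : bool :=
  if s is x :: t then C pre x && chain C (rcons pre x) t else true.

Lemma chainP x0 C pre s i : chain C pre s -> (i < size s)%N ->
  C (pre ++ take i s) (nth x0 s i).
Proof.
elim: s pre i => //= x s IH pre [|i] /andP[Cx Cs] /=; first by rewrite cats0.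
by rewrite ltnS => /(IH _ _ Cs); rewrite cat_rcons.
Qed.

Lemma Pr_chain (rho : R) m (C : seq V -> pred V) (pre : seq V) : 0 <= rho ->
  (forall pre', (size pre' < size pre + m)%N -> rho <= avg U (fun x => (C pre' x)%:R)) ->
  rho ^+ m <= Pr U m (chain C pre).
Proof.
move=> r0; elim: m pre => [|m IH] pre H.
  by rewrite expr0 /Pr /=.
have -> : Pr U m.+1 (chain C pre) =
  avg U (fun x => Em U m (fun s => (C pre x && chain C (rcons pre x) s)%:R)) by [].
have /(ler_wpM2l (exprn_ge0 m r0)) : rho <= avg U (fun x => (C pre x)%:R).
  by apply: H; lia.
rewrite -exprSr => /le_trans; apply; rewrite -avgZ; apply: avg_le => x xU.
case: (C pre x); last by rewrite mulr0 -[leLHS](Em_const U_gt0 m); apply: Em_le.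
by rewrite mulr1; apply: (IH (rcons pre x)) => pre'; rewrite size_rcons => ?; apply: H; lia.
Qed.

Lemma Pr_union m P (I : Type) (r : seq I) (B : I -> pred (seq V)) (e : R) :
  (forall i, Pr U m (B i) <= e) ->
  Pr U m P - (size r)%:R * e <= Pr U m (fun s => P s && ~~ has (B^~ s) r).
Proof.
move=> Be; elim: r => [|i r IH] /=.
  by rewrite mul0r subr0; apply: Pr_le => s; rewrite andbT.
rewrite -addn1 natrD mulrDl mul1r opprD addrA.
apply: le_trans (_ : _ <= _ - Pr U m (B i)) _; first exact: (lerB IH (Be i)).
rewrite -EmB; apply: Em_le => s _ _.
by case: (P s); case: (B i s); case: (has _ r) => /=; rewrite ?subrr ?subr0 ?sub0r ?oppr_le0 ?ler01.
Qed.
End Blowup.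

(** * Locally good sequences *)

Section LocalGoodness.
Variables (V : finType) (x0 : V) (adj : rel V) (bad : V -> V -> V -> bool) (k : nat).
Implicit Types (z q r s : seq V) (i j l p : nat).
Local Notation "z @_ i" := (nth x0 z i) (at level 3, i at level 2, left associativity).

Definition near i j := [&& i != j, i <= j + k & j <= i + k]%N.
(** The centre is [j]: two distinct edges of the power meet there, with outer ends [i] and [l]. *)
Definition triple i j l := [&& near i j, near l j & i != l].

Definition adj_ok z :=
  all (fun i => all (fun j => near i j ==> adj z@_i z@_j) (iota 0 (size z))) (iota 0 (size z)).

Definition tri_ok z :=
  all (fun i => all (fun j => all (fun l => triple i j l ==> ~~ bad z@_i z@_j z@_l)
    (iota 0 (size z))) (iota 0 (size z))) (iota 0 (size z)).

(* [kpath z]: the k-th power of the path [z] (whose vertices need not be distinct)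
   lies in [adj] and contains no pair of edges that is [bad] at its centre. *)
Definition kpath z := adj_ok z && tri_ok z.

Lemma adj_okP z : reflect
  (forall i j, i < size z -> j < size z -> near i j -> adj z@_i z@_j)%N (adj_ok z).
Proof.
apply: (iffP allP) => [H i j iz jz|H i].
  have iI n : (n < size z)%N -> n \in iota 0 (size z) by rewrite mem_iota.
  exact/implyP/(allP (H i (iI i iz)) j (iI j jz)).
rewrite mem_iota => /andP[_ iz]; apply/allP => j; rewrite mem_iota => /andP[_ jz].
by apply/implyP; apply: H.
Qed.

Lemma tri_okP z : reflect
  (forall i j l, i < size z -> j < size z -> l < size z -> triple i j l ->
    ~~ bad z@_i z@_j z@_l)%N (tri_ok z).
Proof.
apply: (iffP allP) => [H i j l iz jz lz|H i].
  have iI n : (n < size z)%N -> n \in iota 0 (size z) by rewrite mem_iota.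
  exact/implyP/(allP (allP (H i (iI i iz)) j (iI j jz)) l (iI l lz)).
rewrite mem_iota => /andP[_ iz]; apply/allP => j; rewrite mem_iota => /andP[_ jz].
apply/allP => l; rewrite mem_iota => /andP[_ lz].
by apply/implyP; apply: H.
Qed.

Lemma near_add a i j : near (a + i) (a + j) = near i j.
Proof. by rewrite /near eqn_add2l -!addnA !leq_add2l. Qed.

Lemma triple_add a i j l : triple (a + i) (a + j) (a + l) = triple i j l.
Proof. by rewrite /triple !near_add eqn_add2l. Qed.

Lemma kpath_infix (p z q : seq V) : kpath (p ++ z ++ q) -> kpath z.
Proof.
have nthE i : (i < size z)%N -> z@_i = (p ++ z ++ q)@_(size p + i).
  by move=> iz; rewrite nth_cat ltnNge leq_addr /= addKn nth_cat iz.
have szE i : (i < size z)%N -> (size p + i < size (p ++ z ++ q))%N.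
  by rewrite !size_cat; lia.
case/andP => /adj_okP A /tri_okP T; apply/andP; split.
  apply/adj_okP => i j iz jz ij; rewrite !nthE //.
  by apply: A; rewrite ?szE ?near_add.
apply/tri_okP => i j l iz jz lz ijl; rewrite !nthE //.
by apply: T; rewrite ?szE ?triple_add.
Qed.

Lemma kpath_prefix z q : kpath (z ++ q) -> kpath z.
Proof. exact: (@kpath_infix [::]). Qed.

Lemma kpath_suffix (p z : seq V) : kpath (p ++ z) -> kpath z.
Proof. by rewrite -{1}(cats0 z); apply: kpath_infix. Qed.

(* Every condition only involves positions that are at most [2k] apart. *)
Lemma kpath_glue (p q r : seq V) : (2 * k <= size q)%N ->
  kpath (p ++ q) -> kpath (q ++ r) -> kpath (p ++ q ++ r).
Proof.
move=> kq.
have E1 i : (i < size (p ++ q))%N -> (p ++ q ++ r)@_i = (p ++ q)@_i.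
  by move=> iz; rewrite catA nth_cat iz.
have E2 i : (p ++ q ++ r)@_(size p + i) = (q ++ r)@_i.
  by rewrite nth_cat ltnNge leq_addr /= addKn.
have S2 i : (size p + i < size (p ++ q ++ r))%N -> (i < size (q ++ r))%N.
  by rewrite !size_cat; lia.
have sE : size (p ++ q) = (size p + size q)%N by rewrite size_cat.
case/andP => /adj_okP A1 /tri_okP T1 /andP[/adj_okP A2 /tri_okP T2].
apply/andP; split.
  apply/adj_okP => i j iz jz ij.
  have [mx|mx] := ltnP (maxn i j) (size (p ++ q)).
    by rewrite !E1 ?A1 //; lia.
  move: (ij); rewrite /near => /and3P[_ ij1 ij2].
  have /subnKC Ei : (size p <= i)%N by lia.
  have /subnKC Ej : (size p <= j)%N by lia.
  move: iz jz ij; rewrite -Ei -Ej !E2 near_add => /S2 iz /S2 jz ij.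
  exact: A2.
apply/tri_okP => i j l iz jz lz ijl.
have [mx|mx] := ltnP (maxn (maxn i j) l) (size (p ++ q)).
  by rewrite !E1 ?T1 //; lia.
move: (ijl); rewrite /triple /near => /and3P[/and3P[_ ij1 ij2] /and3P[_ lj1 lj2] _].
have /subnKC Ei : (size p <= i)%N by lia.
have /subnKC Ej : (size p <= j)%N by lia.
have /subnKC El : (size p <= l)%N by lia.
move: iz jz lz ijl; rewrite -Ei -Ej -El !E2 triple_add => /S2 iz /S2 jz /S2 lz ijl.
exact: T2.
Qed.

(** A template entry is a fixed vertex ([inl], a root) or the index of a random variable ([inr]). *)
Definition slot := (V + nat)%type.

Definition interp s (a : slot) := match a with inl v => v | inr i => s@_i end.

Definition free_slots (sl : seq slot) : seq nat :=
  pmap (fun a : slot => if a is inr i then Some i else None) sl.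

(** A random outer entry already makes badness of a triple rare. If both outer entries are roots,
    then either the centre is random, and [adj u w] gives access to [bad_centre], or all three are
    roots and the triple has to be good from the start. *)
Definition slots_ok (sl : seq slot) (m : nat) :=
  [/\ all (fun i => i < m)%N (free_slots sl), uniq (free_slots sl) &
   forall i j l u w, (i < size sl)%N -> (j < size sl)%N -> (l < size sl)%N -> triple i j l ->
     nth (inl x0) sl i = inl u -> nth (inl x0) sl l = inl w ->
     match nth (inl x0) sl j with inl v => ~~ bad u v w | inr _ => adj u w end].

Lemma nth_map_interp s (sl : seq slot) i : (i < size sl)%N ->
  (map (interp s) sl)@_i = interp s (nth (inl x0) sl i).
Proof. by move=> isl; rewrite (nth_map (inl x0)). Qed.

Lemma free_slotsP (sl : seq slot) (p : nat) : reflect (exists2 i, (i < size sl)%N & nth (inl x0) sl i = inr p)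
  (p \in free_slots sl).
Proof.
rewrite mem_pmap; apply: (iffP mapP) => [[[v|q] // /(nthP (inl x0))[i isl E] [->]]|[i isl E]].
  by exists i.
by exists (inr p); rewrite // -E mem_nth.
Qed.

Lemma free_slots_inj (sl : seq slot) i j (p : nat) : uniq (free_slots sl) -> (i < size sl)%N -> (j < size sl)%N ->
  nth (inl x0) sl i = inr p -> nth (inl x0) sl j = inr p -> i = j.
Proof.
have memp n t : (n < size t)%N -> nth (inl x0) t n = inr p -> p \in free_slots t.
  by move=> nt E; apply/free_slotsP; exists n.
elim: sl i j => [|a sl IH] [|i] [|j] //=; rewrite ?ltnS.
- by move=> + _ jsl aE E; rewrite aE /= (memp _ _ jsl E).
- by move=> + isl _ E aE; rewrite aE /= (memp _ _ isl E).
- move=> u isl jsl Ei Ej; congr S; apply: IH => //.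
  by case: a u => //= q /andP[].
Qed.

(** * Random fillings of a template *)

Section Random.
Variables (R : realType) (U : {set V}) (nu : R).
Hypothesis U_gt0 : (0 < #|U|)%N.
Hypothesis badC : forall u v w, bad u v w = bad w v u.
Hypothesis bad_outer : forall u v, #|[set w | bad u v w]|%:R <= nu.
Hypothesis bad_centre : forall u w, adj u w -> #|[set v | bad u v w]|%:R <= nu.

Definition slots_good (X : {set V}) (sl : seq slot) s :=
  [&& tri_ok (map (interp s) sl), uniq (map (nth x0 s) (free_slots sl))
    & all (fun p => s@_p \notin X) (free_slots sl)].

Lemma avg_le_card (Q : pred V) (e : R) : #|[set x | Q x]|%:R <= e * #|U|%:R ->
  avg U (fun x => (Q x)%:R) <= e.
Proof.
move=> Qe; rewrite avg_card ler_pdivrMr ?cardU_gt0 //; apply: le_trans Qe.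
by rewrite ler_nat subset_leq_card //; apply/subsetP => x; rewrite !inE => /andP[].
Qed.

Lemma interp_set s (p : nat) x (a : slot) : interp (set_nth x0 s p x) a = if a == inr p then x else interp s a.
Proof. by case: a => //= q; rewrite nth_set_nth /=; congr (if _ then _ else _). Qed.

(** Union bound over bad triples [B1], coincidences [B2] and entries in [X] ([B3]). Different slots
    carry different variables, so each event can be tested by resampling one variable alone, and it
    has probability at most [e]. *)
Lemma Pr_slots_good (sl : seq slot) (m : nat) (X : {set V}) (P : pred (seq V)) (e : R) : slots_ok sl m ->
  nu <= e * #|U|%:R -> 1 <= e * #|U|%:R -> #|X|%:R <= e * #|U|%:R ->
  Pr R U m P - (3 * size sl ^ 3)%:R * e <= Pr R U m (fun s => P s && slots_good X sl s).
Proof.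
move=> [/allP fm fu roots] nue e1 Xe; set N := size sl; pose zz s := map (interp s) sl.
pose sl_ i := nth (inl x0) sl i.
have e0 : 0 <= e by rewrite -(pmulr_lge0 _ (cardU_gt0 R U_gt0)) (le_trans ler01).
have bad_left u w : #|[set v | bad v u w]|%:R <= nu.
  by rewrite -(eq_card (_ : [set v | bad w u v] =i _)) // => v; rewrite !inE badC.
have setE s p x i : (i < N)%N -> (zz (set_nth x0 s p x))@_i =
    if sl_ i == inr p then x else (zz s)@_i.
  by move=> iN; rewrite !nth_map_interp // interp_set.
have neq i j p : (i < N)%N -> (j < N)%N -> i != j -> sl_ i = inr p -> (sl_ j == inr p) = false.
  move=> iN jN ij Ei; apply/eqP => Ej; move/eqP: ij; apply.
  exact: (free_slots_inj fu iN jN Ei Ej).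
have pm i p : (i < N)%N -> sl_ i = inr p -> (p < m)%N.
  by move=> iN Ei; apply: fm; apply/free_slotsP; exists i.
have bound0 (B : pred (seq V)) : (forall s, B s = false) -> Pr R U m B <= e.
  move=> B0; rewrite -[e](Em_const U_gt0 m); apply: Em_le => // s _ _.
  by rewrite B0.
have bound (B : pred (seq V)) p i : (i < N)%N -> sl_ i = inr p ->
    (forall s, exists2 Q : pred V, (forall x, B (set_nth x0 s p x) = Q x) &
       #|[set x | Q x]|%:R <= e * #|U|%:R) -> Pr R U m B <= e.
  move=> iN Ei H; apply: (Em_coord U_gt0 (x0 := x0) (pm _ _ iN Ei)) => s _.
  have [Q QE Qe] := H s; apply: le_trans (avg_le_card Qe).
  by rewrite (@eq_avg _ _ U _ (fun x => (Q x)%:R)) // => x; rewrite QE.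
(* The pairs of [B2] and the single positions of [B3] are padded to triples, so that all three
   families share one index type. *)
pose T : finType := ('I_N * 'I_N * 'I_N)%type.
pose B1 (t : T) s := triple t.1.1 t.1.2 t.2 &&
  bad (zz s)@_(t.1.1) (zz s)@_(t.1.2) (zz s)@_(t.2).
pose isf i := if sl_ i is inr _ then true else false.
pose B2 (t : T) s := [&& t.1.1 != t.1.2, isf t.1.1 & (zz s)@_(t.1.1) == (zz s)@_(t.1.2)].
pose B3 (t : T) s := isf t.1.1 && ((zz s)@_(t.1.1) \in X).
have B1e t : Pr R U m (B1 t) <= e.
  case: t => [[[i iN] [j jN]] [l lN]]; rewrite /B1 /=.
  case tr: (triple i j l); last exact: bound0.
  have [ij lj il] : [/\ i != j, l != j & i != l].
    by move: tr; rewrite /triple /near => /and3P[/and3P[-> _ _] /and3P[-> _ _] ->].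
  (* A random outer entry is resampled if there is one; between two outer roots the centre is
     resampled. *)
  case El: (sl_ l) => [w|p].
    case Ei: (sl_ i) => [u|p].
      case Ej: (sl_ j) (roots i j l u w iN jN lN tr Ei El) => [v|p]; rewrite -/(sl_ j) Ej.
        move=> nb; apply: bound0 => s /=; apply/negbTE.
        by rewrite !nth_map_interp // -!/(sl_ _) Ei El Ej.
      move=> uw; apply: (bound _ p j jN Ej) => s; exists (fun x => bad u x w).
        move=> x /=; rewrite !nth_map_interp // -!/(sl_ _) Ei El Ej /=.
        by rewrite nth_set_nth /= eqxx.
      exact: le_trans (bad_centre uw) nue.
    apply: (bound _ p i iN Ei) => s; exists (fun x => bad x (zz s)@_j (zz s)@_l).
      by move=> x /=; rewrite !setE // Ei eqxx (neq _ _ _ iN jN ij Ei) (neq _ _ _ iN lN il Ei).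
    exact: le_trans (bad_left _ _) nue.
  rewrite eq_sym in il.
  apply: (bound _ p l lN El) => s; exists (fun x => bad (zz s)@_i (zz s)@_j x).
    by move=> x /=; rewrite !setE // El eqxx (neq _ _ _ lN jN lj El) (neq _ _ _ lN iN il El).
  exact: le_trans (bad_outer _ _) nue.
have B2e t : Pr R U m (B2 t) <= e.
  case: t => [[[i iN] [j jN]] [l lN]]; rewrite /B2 /=.
  case: (eqVneq (Ordinal iN) (Ordinal jN)) => [|ij] /=; first by move=> _; apply: bound0.
  have {}ij : i != j by [].
  rewrite /isf; case Ei: (sl_ i) => [u|p]; first by apply: bound0.
  apply: (bound _ p i iN Ei) => s; exists (fun x => x == (zz s)@_j).
    by move=> x /=; rewrite !setE // Ei eqxx (neq _ _ _ iN jN ij Ei).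
  by rewrite -[[set x | _]]/[set x in pred1 _] cardsE card1.
have B3e t : Pr R U m (B3 t) <= e.
  case: t => [[[i iN] [j jN]] [l lN]]; rewrite /B3 /= /isf.
  case Ei: (sl_ i) => [u|p]; first by apply: bound0.
  apply: (bound _ p i iN Ei) => s; exists (fun x => x \in X).
    by move=> x /=; rewrite !setE // Ei eqxx.
  by rewrite -[[set x | _]]/[set x in X] cardsE.
have := Pr_union P (enum T) B1e.
set P1 := (fun s => _); have := Pr_union P1 (enum T) B2e.
set P2 := (fun s => _); have := Pr_union P2 (enum T) B3e.
set P3 := (fun s => _); have -> : size (enum T) = (N ^ 3)%N.
  by rewrite -cardE !card_prod card_ord; lia.
rewrite natrM => H3 H2 H1.
apply: le_trans (_ : _ <= Pr R U m P3) _; first by lra.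
apply: Pr_le => // s ss sU.
rewrite /P3 /P2 /P1 => /andP[/andP[/andP[-> /hasPn h1] /hasPn h2] /hasPn h3] /=.
apply/and3P; split.
- apply/tri_okP => i j l; rewrite !size_map => iN jN lN tr.
  have := h1 (Ordinal iN, Ordinal jN, Ordinal lN); rewrite mem_enum => /(_ isT).
  by rewrite /B1 /= tr.
- rewrite map_inj_in_uniq // => p q /free_slotsP[i iN Ei] /free_slotsP[j jN Ej] E.
  have := h2 (Ordinal iN, Ordinal jN, Ordinal jN); rewrite mem_enum => /(_ isT).
  rewrite /B2 /= /isf /sl_ Ei /= !nth_map_interp // Ei Ej /= E eqxx andbT negbK.
  by move=> /eqP[ij]; move: Ei; rewrite ij Ej => -[].
- apply/allP => p /free_slotsP[i iN Ei].
  have := h3 (Ordinal iN, Ordinal iN, Ordinal iN); rewrite mem_enum => /(_ isT).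
  by rewrite /B3 /= /isf /sl_ Ei /= nth_map_interp // Ei.
Qed.
End Random.
End LocalGoodness.

(** * Connecting *)

Section ConnectingWalk.
Variable k : nat.
Implicit Types (F P p q t : nat).
Local Open Scope nat_scope.
Local Notation K := k.+1.
Definition conn_len := k * K + k.
Local Notation ell := conn_len.

(* The variables of the template are listed after the [2k] roots
   [q_0 ... q_(k-1) r_0 ... r_(k-1)]: first [r'_(k-1), ..., r'_0], at indices
   [2k, ..., 3k-1], then one variable for each of the [k (k+1)] positions of the
   walk that precede its final segment [r'_0 ... r'_(k-1)]. Position
   [t (k+1) + q] of the walk is occupied by [r'_q] if [q < t], and otherwise by
   its own variable. *)
Definition label P :=
  if P < k then P else
  if P < k + ell then
    let p := P - k in if p %% K < p %/ K then 3 * k - 1 - p %% K else 3 * k + p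
  else P - ell.

(** The earlier indices to which [F] has to be adjacent. The variable r'_t sees r_0, ..., r_t and
    all r'_u with u > t. A walk variable of round t sees the [k] preceding positions and r'_t, which
    the next round puts in place. *)
Definition constraints F :=
  if F < 3 * k then iota k (3 * k - F) ++ iota (2 * k) (F - 2 * k)
  else rcons (map label (iota (F - 3 * k) k)) (3 * k - 1 - (F - 3 * k) %/ K).

Lemma size_constraints F : 2 * k <= F -> size (constraints F) <= K.
Proof.
rewrite /constraints => F2; case: ifP => F3.
  by rewrite size_cat !size_iota; lia.
by rewrite size_rcons size_map size_iota.
Qed.

Lemma labelP P : k <= P < k + ell -> exists t q,
  [/\ P = k + (t * K + q), q <= k, t <= k, t = k -> q < k &
      label P = if q < t then 3 * k - 1 - q else 3 * k + (t * K + q)].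
Proof.
move=> /andP[kP Pl]; exists ((P - k) %/ K), ((P - k) %% K).
have E := divn_eq (P - k) K.
have m : (P - k) %% K < K by rewrite ltn_pmod.
have d : (P - k) %/ K <= k.
  by rewrite -ltnS ltn_divLR //; move: Pl; rewrite /conn_len; nia.
split => //.
- by rewrite -E subnKC.
- by move: Pl E; rewrite /conn_len => Pl E dk; rewrite dk in E; lia.
- by rewrite /label ltnNge kP /= Pl -E.
Qed.

Lemma labelE t q : q < K -> t * K + q < ell ->
  label (k + (t * K + q)) = if q < t then 3 * k - 1 - q else 3 * k + (t * K + q).
Proof.
move=> qK tq; rewrite /label ltnNge leq_addr /= ltn_add2l tq addKn.
by rewrite modnMDl divnMDl // modn_small // divn_small // addn0.
Qed.

Lemma label_var P : k <= P < k + ell -> 2 * k <= label P < 3 * k + k * K.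
Proof.
move=> /labelP [t [q [_ qk tk tq ->]]]; case: ifP => qt; first by nia.
have : t < k by lia.
by nia.
Qed.

(** Every required adjacency was imposed when the later of the two variables was chosen. The bounds
    [k <= P2] and [P1 < k + ell] exclude two roots on the same side. *)
Lemma label_constraints P1 P2 : P1 < P2 -> P2 <= P1 + k -> P2 < 2 * k + ell ->
  k <= P2 -> P1 < k + ell ->
  let: (A, B) := (label P1, label P2) in
  (A < B /\ A \in constraints B /\ 2 * k <= B < 3 * k + k * K) \/
  (B < A /\ B \in constraints A /\ 2 * k <= A < 3 * k + k * K).
Proof.
move=> P12 P21 P2l kP2 P1l.
have lE : ell = k * K + k by [].
have [P2e|P2e] := leqP (k + ell) P2.
  have kP1 : k <= P1 < k + ell by lia.
  have [t1 [q1 [E1 q1k t1k tq1 ->]]] := labelP kP1.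
  (* Only the final segment comes within distance [k] of the right roots, and there r'_q reaches
     exactly r_0, ..., r_q. *)
  have t1E : t1 = k.
    have [tk|] := ltnP t1 k; last by lia.
    have : t1.+1 * K <= k * K by rewrite leq_mul2r; lia.
    by rewrite mulSn; lia.
  subst t1; rewrite tq1 //; right.
  have -> : label P2 = P2 - ell.
    by rewrite /label ltnNge kP2 ltnNge P2e.
  have q1k' := tq1 erefl.
  have h : P2 - ell <= k + q1 by lia.
  have h' : k <= P2 - ell by lia.
  split; first by lia.
  split; last by lia.
  rewrite /constraints ifT; last by lia.
  by rewrite mem_cat mem_iota; apply/orP; left; lia.
have kP2' : k <= P2 < k + ell by lia.
have [t2 [q2 [E2 q2k t2k tq2 L2]]] := labelP kP2'; rewrite L2.
have vP2 := label_var kP2'; rewrite L2 in vP2.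
case: (ltnP q2 t2) L2 vP2 => [qt2|tq2'] L2 vP2; last first.
  have t2k' : t2 < k by lia.
  left; split; last split=> //.
    have [P1k|kP1] := ltnP P1 k; first by rewrite /label P1k; lia.
    have kP1' : k <= P1 < k + ell by lia.
    have [t1 [q1 [E1 q1k t1k tq1 ->]]] := labelP kP1'.
    by case: ifP; lia.
  rewrite /constraints ifF; last by lia.
  rewrite mem_rcons inE; apply/orP; right; apply: map_f.
  by rewrite mem_iota; lia.
have kP1 : k <= P1 < k + ell by rewrite P1l andbT; nia.
have [t1 [q1 [E1 q1k t1k tq1 L1]]] := labelP kP1; rewrite L1.
have vP1 := label_var kP1; rewrite L1 in vP1.
case: (ltnP q1 t1) L1 vP1 => [qt1|tq1'] L1 vP1.
  have [q12|q12|q12] := ltngtP q1 q2.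
  - right; split; first by lia.
    split => //; rewrite /constraints ifT; last by lia.
    by rewrite mem_cat !mem_iota; apply/orP; right; lia.
  - left; split; first by lia.
    split => //; rewrite /constraints ifT; last by lia.
    by rewrite mem_cat !mem_iota; apply/orP; right; lia.
  - exfalso; subst q2; have t12 : t1 < t2.
      rewrite ltnNge; apply/negP => t21.
      have : t2 * K <= t1 * K by rewrite leq_mul2r t21 orbT.
      by lia.
    have : t1.+1 * K <= t2 * K by rewrite leq_mul2r t12 orbT.
    by rewrite mulSn; lia.
(* A free position is followed by a fixed one of the next round. The latter is r'_t1, seen by all of
   round [t1], or an r'_q2 with q2 < t1, which also occurred [k.+1] steps earlier and so precedes
   the free position closely. *)
have tE : t2 = t1.+1.
  have t12 : t1 < t2.
    rewrite ltnNge; apply/negP => t21.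
    have : t2 * K <= t1 * K by rewrite leq_mul2r t21 orbT.
    by lia.
  have [//|t21|//] := ltngtP t2 t1.+1; first by lia.
  have : t1.+2 * K <= t2 * K by rewrite leq_mul2r t21 orbT.
  by rewrite !mulSn; lia.
subst t2; right; split; first by lia.
split => //; rewrite /constraints ifF; last by lia.
rewrite addKn divnMDl // divn_small; last by lia.
rewrite addn0 mem_rcons inE; move: qt2; rewrite ltnS leq_eqVlt => /orP[/eqP->|qt2].
  by rewrite eqxx.
apply/orP; right; apply/mapP; exists (k + (t1 * K + q2)).
  by rewrite mem_iota; lia.
by rewrite labelE ?qt2 //; rewrite /conn_len; nia.
Qed.
End ConnectingWalk.

Ltac drop_real := repeat match goal with
  | H : is_true (@Order.le _ _ _ _) |- _ => clear H
  | H : is_true (@Order.lt _ _ _ _) |- _ => clear H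
  | H : forall _, _ |- _ => clear H
  | H : is_true (all _ _) |- _ => clear H
  | H : is_true (uniq _) |- _ => clear H
  | H := _ : seq _ |- _ => clearbody H
  | H := _ : _ -> _ |- _ => clearbody H
  end.
Ltac nlia := drop_real; lia.
Ltac nnia := drop_real; nia.

Section Connecting.
Variables (R : realType) (V : finType) (x0 : V) (adj : rel V) (bad : V -> V -> V -> bool).
Variables (k : nat) (nu : R).
Implicit Types (U X : {set V}) (s z : seq V) (i j l : nat).
Local Notation kpath := (kpath x0 adj bad k).

(* [nu] is an absolute bound: a proportion of the vertices times their number. *)
Definition sparse_system := [/\ symmetric adj, forall u v w, bad u v w = bad w v u,
  forall u v, #|[set w | bad u v w]|%:R <= nu &
  forall u w, adj u w -> #|[set v | bad u v w]|%:R <= nu].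

Definition dense U (beta : R) :=
  forall v, #|[set x in U | ~~ adj v x]|%:R <= beta * #|U|%:R.

(** Union bound over [D]. With [beta] below 1/(k+1), any k+1 vertices keep a positive proportion of
    common neighbours. *)
Lemma avg_common U beta (D : seq V) : (0 < #|U|)%N -> dense U beta ->
  1 - (size D)%:R * beta <= avg U (fun x => (all (fun v => adj v x) D)%:R).
Proof.
move=> U0 dU; elim: D => [|v D IH] /=; first by rewrite mul0r subr0 avg_const.
rewrite -[(size D).+1]addn1 natrD mulrDl mul1r opprD addrA.
have h : avg U (fun x => (~~ adj v x)%:R) <= beta.
  by rewrite avg_card ler_pdivrMr ?cardU_gt0 //.
apply: le_trans (lerB IH h) _; rewrite lerBlDr -avgD; apply: avg_le => x _.
by case: (adj v x) => /=; case: (all _ _) => /=; rewrite ?addr0 ?add0r ?lexx ?ler01.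
Qed.

Lemma free_slots_cat (A B : seq (slot V)) :
  free_slots (A ++ B) = free_slots A ++ free_slots B.
Proof. exact: pmap_cat. Qed.

Lemma free_slots_roots s : free_slots (map inl s : seq (slot V)) = [::].
Proof. by elim: s. Qed.

Lemma free_slots_free (s : seq nat) : free_slots (map inr s : seq (slot V)) = s.
Proof. by elim: s => //= i s ->. Qed.

(** Each of the [k + k * k.+1] template variables is blown up to one copy per position of the
    walk. *)
Definition conn_prob (rho : R) : R :=
  bu_bound (conn_len k) (k + k * k.+1) (rho ^+ (k + k * k.+1)).

(** Fillings of the template with all adjacencies are dense by [Pr_chain], hence so are their
    blow-ups. Each position gets its own copy of its variable, and [Pr_slots_good] makes these
    distinct, outside [X] and free of bad triples. The roots have length [2 * k] because a triple
    can reach that far back. *)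
Lemma connect_roots U X (Q2 R2 : seq V) (beta e : R) : sparse_system -> (0 < k)%N ->
  (0 < #|U|)%N -> dense U beta -> nu <= e * #|U|%:R -> 1 <= e * #|U|%:R ->
  #|X|%:R <= e * #|U|%:R -> 0 < 1 - k.+1%:R * beta ->
  (3 * (4 * k + conn_len k) ^ 3)%:R * e < conn_prob (1 - k.+1%:R * beta) ->
  size Q2 = (2 * k)%N -> size R2 = (2 * k)%N -> kpath Q2 -> kpath R2 ->
  exists c, [/\ size c = conn_len k, uniq c, all (mem U) c,
    all (fun x => x \notin X) c & kpath (Q2 ++ c ++ R2)].
Proof.
move=> [adjC badC bad_o bad_c] k0 U0 dU nue e1 Xe rho0 small sQ sR kQ kR.
set ell := conn_len k in small *; set m := (k + k * k.+1)%N.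
set rho := 1 - _ in rho0 small.
have lE : ell = (k * k.+1 + k)%N by [].
pose Q := drop k Q2; pose R_ := take k R2.
have sQk : size Q = k by rewrite size_drop sQ; nlia.
have sRk : size R_ = k by rewrite size_takel // sR; nlia.
pose pre := Q ++ R_.
have spre : size pre = (2 * k)%N by rewrite size_cat sQk sRk; nlia.
pose C p x := all (fun v => adj v x) (map (nth x0 p) (constraints k (size p))).
pose chain' s := chain C pre s.
have Hchain : rho ^+ m <= Pr R U m chain'.
  (* [Pr_chain] asks about every short history, but [size_constraints] needs the [2 * k] roots to be
     present; the guard makes shorter histories trivial. *)
  have H := @Pr_chain R V U U0 rho m (fun p x => (2 * k <= size p)%N ==> C p x) pre (ltW rho0).
  have {}H := H _; apply: le_trans (H _) _ => [p _|].
    have [p2|p2] := leqP (2 * k) (size p); last first.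
      rewrite (avg_const U0); rewrite /rho lerBlDr lerDl mulr_ge0 ?ler0n //.
      have := dU x0; rewrite -ler_pdivrMr ?cardU_gt0 //; apply: le_trans.
      by rewrite divr_ge0 // ler0n.
    apply: le_trans (avg_common _ U0 dU); rewrite lerB // ler_wpM2r //.
      have := dU x0; rewrite -ler_pdivrMr ?cardU_gt0 //; apply: le_trans.
      by rewrite divr_ge0 // ler0n.
    by rewrite ler_nat size_map size_constraints.
  apply: Pr_le => // s _ _; rewrite /chain'.
  have : (2 * k <= size pre)%N by rewrite spre.
  elim: s (pre) => //= x s IH p p2 /andP[]; rewrite p2 /= => -> /IH; apply.
  by rewrite size_rcons; nlia.
have Hbu := Pr_blowup U0 ell (exprn_gt0 m rho0) Hchain.
(* Entry [p] of the block of its variable: reduction modulo [ell] recovers [p], so different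
   positions use different copies. *)
pose pos p := ((label k (k + p) - 2 * k) * ell + p)%N.
pose sl : seq (slot V) := map inl Q2 ++ map inr (map pos (iota 0 ell)) ++ map inl R2.
have posP p : (p < ell)%N -> (2 * k <= label k (k + p) < 2 * k + m)%N.
  move=> pl; have := @label_var k (k + p); rewrite leq_addr ltn_add2l pl => /(_ isT).
  by rewrite /m; nlia.
have fsl : free_slots sl = map pos (iota 0 ell).
  by rewrite !free_slots_cat !free_slots_roots free_slots_free cats0.
have ssl : size sl = (4 * k + ell)%N.
  by rewrite !size_cat !size_map size_iota sQ sR; nlia.
have nth_sl i : nth (inl x0) sl i = if (i < 2 * k)%N then inl (nth x0 Q2 i) else
    if (i < 2 * k + ell)%N then inr (pos (i - 2 * k)%N) else inl (nth x0 R2 (i - 2 * k - ell)).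
  rewrite nth_cat size_map sQ; case: ltnP => i1; first by rewrite (nth_map x0) ?sQ.
  rewrite nth_cat !size_map size_iota ltn_subLR //; case: ltnP => i2.
    rewrite (nth_map 0%N) ?size_map ?size_iota; last by nlia.
    by rewrite (nth_map 0%N) ?size_iota ?nth_iota //; nlia.
  have [i3|i3] := ltnP (i - 2 * k - ell) (2 * k); first by rewrite (nth_map x0) ?sR.
  by rewrite !nth_default ?size_map ?sR.
have slok : slots_ok x0 adj bad k sl (m * ell).
  split.
  - rewrite fsl; apply/allP => _ /mapP[p + ->]; rewrite mem_iota /= => pl.
    have /andP[p1 p2] := posP p pl; rewrite /pos.
    have : (label k (k + p) - 2 * k < m)%N by nlia.
    by nnia.
  - rewrite fsl map_inj_in_uniq ?iota_uniq // => p q.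
    rewrite !mem_iota /= => pl ql /(congr1 (modn^~ ell)).
    by rewrite /pos !modnMDl !modn_small.
  - move=> i j l u w; rewrite ssl => iz jz lz tr.
    have := tr; rewrite /triple /near => /and3P[/and3P[ij ij1 ij2] /and3P[lj lj1 lj2] il].
    rewrite !nth_sl.
    case: (ltnP i (2 * k)) => i1.
      move=> [<-].
      case: (ltnP l (2 * k)) => l1.
2: by case: ltnP => // l2 _; nlia.
      move=> [<-]; case: (ltnP j (2 * k)) => j1.
        by case/andP: kQ => _ /tri_okP; apply; rewrite ?sQ.
      case: ifP => j2; last by nlia.
      case/andP: kQ => /adj_okP A _; apply: A; rewrite ?sQ // /near il /=; nlia.
    case: (ltnP i (2 * k + ell)) => // i2 [<-].
    case: (ltnP l (2 * k)) => l1; first by nlia.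
    case: (ltnP l (2 * k + ell)) => // l2 [<-].
    case: (ltnP j (2 * k)) => j1; first by nlia.
    case: (ltnP j (2 * k + ell)) => j2.
      by case/andP: kR => /adj_okP A _; apply: A; rewrite ?sR // /near; nlia.
    by case/andP: kR => _ /tri_okP; apply; rewrite ?sR /triple /near; nlia.
have := Pr_slots_good U0 badC bad_o bad_c (bu ell m chain') slok nue e1 Xe.
set Good := (fun s => _ && _); rewrite ssl => HG.
have /(Pr_exists U0)[S [sS SU /andP[buS /and3P[tS uS XS]]]] : 0 < Pr R U (m * ell) Good.
  by apply: lt_le_trans HG; rewrite subr_gt0; apply: lt_le_trans Hbu.
pose c := map (nth x0 S) (map pos (iota 0 ell)).
rewrite fsl in uS XS.
have sc : size c = ell by rewrite !size_map size_iota.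
have cE : map (interp x0 S) sl = Q2 ++ c ++ R2.
  rewrite !map_cat -!map_comp; congr (_ ++ (_ ++ _)).
  - by rewrite -[RHS]map_id; apply: eq_map.
  - by rewrite /c -!map_comp; apply: eq_map.
  - by rewrite -[RHS]map_id; apply: eq_map.
have posm p : (p < ell)%N -> (pos p < m * ell)%N.
  by move=> pl; case: slok => /allP H _ _; apply: H; rewrite fsl map_f // mem_iota.
exists c; split => //.
- apply/allP => _ /mapP[_ /mapP[p + ->] ->]; rewrite mem_iota /= => pl.
  by apply: (allP SU); rewrite mem_nth // sS posm.
- by rewrite /c all_map.
apply/andP; split; last by rewrite -cE.
set z := Q2 ++ c ++ R2.
have sz : size z = (4 * k + ell)%N by rewrite !size_cat sc sQ sR; nlia.
(* The template filled by one transversal of the blow-up. Its roots begin at [Q], so position [P] of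
   the template is position [k + P] of [z]. *)
pose full sigma := pre ++ mkseq (fun i => nth x0 S (i * ell + sigma i)) m.
have fullE sigma P : (P < 2 * k + ell)%N ->
    ((k <= P < k + ell)%N -> sigma (label k P - 2 * k)%N = (P - k)%N) ->
    nth x0 (full sigma) (label k P) = nth x0 z (k + P).
  move=> Pl sg; rewrite /full /pre !nth_cat sQk size_cat sQk sRk sQ sc.
  have [Pk|kP] := ltnP P k.
    have -> : label k P = P by rewrite /label Pk.
    have [c1 c2] : (P < k + k)%N /\ (k + P < 2 * k)%N by nlia.
    by rewrite c1 Pk c2 nth_drop.
  have [P1|P1] := ltnP P (k + ell).
    have Pke : (P - k < ell)%N by nlia.
    have := posP _ Pke; rewrite subnKC // => /andP[l1 l2].
    have [c1 c2 c3] : [/\ (label k P < k + k)%N = false, (k + P < 2 * k)%N = false &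
      (k + P - 2 * k < ell)%N] by split; nlia.
    rewrite c1 c2 c3.
    rewrite nth_mkseq; last by nlia.
    have -> : (label k P - (k + k) = label k P - 2 * k)%N by nlia.
    rewrite sg ?kP // (nth_map 0%N) ?size_map ?size_iota; last by nlia.
    rewrite (nth_map 0%N) ?size_iota; last by nlia.
    rewrite nth_iota; last by nlia.
    rewrite /pos; congr (nth x0 S (_ * _ + _)); last by nlia.
    by congr (label k _ - _)%N; nlia.
  have -> : label k P = (P - ell)%N by rewrite /label ltnNge kP ltnNge P1.
  have [c1 c2 c3 c4] : [/\ (P - ell < k + k)%N, (P - ell < k)%N = false,
    (k + P < 2 * k)%N = false & (k + P - 2 * k < ell)%N = false] by split; nlia.
  rewrite c1 c2 c3 c4 nth_take; last by nlia.
  by congr nth; nlia.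
have fullC sigma a b : (forall i, (i < m)%N -> (sigma i < ell)%N) ->
    (a < b)%N -> a \in constraints k b -> (2 * k <= b < 2 * k + m)%N ->
    adj (nth x0 (full sigma) a) (nth x0 (full sigma) b).
  move=> sg ab ac /andP[b1 b2].
  have := bu_transversal x0 sS sg buS; set t := mkseq _ _ => ct.
  have bt : (b - 2 * k < size t)%N by rewrite size_mkseq; nlia.
  have := chainP x0 ct bt; rewrite /C size_cat spre size_takel; last exact: ltnW.
  rewrite subnKC // => /allP/(_ (nth x0 (pre ++ take (b - 2 * k) t) a)).
  rewrite map_f // => /(_ isT).
  rewrite /full nth_cat [in X in adj _ X -> _]/=.
  have -> : nth x0 (pre ++ t) b = nth x0 t (b - 2 * k).
    by rewrite nth_cat spre ltnNge b1.
  congr (is_true (adj _ _)); rewrite nth_cat spre; case: ltnP => // a1.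
  by rewrite nth_take //; nlia.
suff walk i j : (i < j)%N -> (i < size z)%N -> (j < size z)%N -> (j <= i + k)%N ->
    adj (nth x0 z i) (nth x0 z j).
  apply/adj_okP => i j iz jz /and3P[ij ij1 ij2].
  by have [lt|lt|E] := ltngtP i j; [apply: walk| rewrite adjC; apply: walk|nlia].
rewrite sz => ij iz jz jik.
have [j1|j1] := ltnP j (2 * k).
  rewrite !nth_cat sQ j1 (ltn_trans ij j1).
  by case/andP: kQ => /adj_okP A _; apply: A; rewrite ?sQ // /near; nlia.
have [i1|i1] := leqP (2 * k + ell) i.
  rewrite !nth_cat sQ sc !ifF; try nlia.
  by case/andP: kR => /adj_okP A _; apply: A; rewrite ?sR // /near; nlia.
have lk : (2 * k + m = 3 * k + k * k.+1)%N by rewrite /m; nlia.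
have pair Pa Pb : (Pa < 2 * k + ell)%N -> (Pb < 2 * k + ell)%N -> (label k Pb < label k Pa)%N ->
    label k Pb \in constraints k (label k Pa) -> (2 * k <= label k Pa < 2 * k + m)%N ->
    adj (nth x0 z (k + Pb)) (nth x0 z (k + Pa)).
  move=> Pal Pbl ba bc /andP[a1 a2].
  have Pa1 : (Pa < k + ell)%N.
    rewrite ltnNge; apply/negP => aP; have := a1.
    by rewrite /label ltnNge (leq_trans (leq_addr _ _) aP) /= ltnNge aP /=; nlia.
  (* The labels differ, so a single transversal picks the right copies for both positions. The
     [minn] keeps the value below [ell] when [Pb] is a root. *)
  pose sg i' := if (i' == label k Pa - 2 * k)%N then (Pa - k)%N else minn (Pb - k) ell.-1.
  rewrite -(fullE sg Pa) // => [|_]; last by rewrite /sg eqxx.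
  rewrite -(fullE sg Pb) // => [|/andP[b1 b2]]; last first.
    have := @label_var k Pb; rewrite b1 b2 => /(_ isT)/andP[lb1 _].
    rewrite /sg ifF; last by nlia.
    by rewrite (minn_idPl _); nlia.
  by apply: fullC; rewrite ?a1 // => i' _; rewrite /sg; case: ifP; nlia.
have -> : i = (k + (i - k))%N by nlia.
have -> : j = (k + (j - k))%N by nlia.
have := @label_constraints k (i - k) (j - k) _ _ _ _ _.
rewrite -lk; case; try nlia.
  by move=> [ab [ac bb]]; apply: pair => //; nlia.
by move=> [ab [ac bb]]; rewrite adjC; apply: pair => //; nlia.
Qed.
End Connecting.

(** * Absorbers *)

Section Absorbers.
Variables (R : realType) (V : finType) (x0 : V) (adj : rel V) (bad : V -> V -> V -> bool).
Variables (k : nat) (nu : R).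
Implicit Types (U X : {set V}) (s z : seq V) (i j l : nat).
Local Notation kpath := (kpath x0 adj bad k).

(** Both halves have length [2 * k], so by [kpath_glue] inserting [v] between them is harmless for
    everything outside the segment. *)
Definition absorbs v s :=
  [&& size s == (4 * k)%N, kpath s & kpath (take (2 * k) s ++ v :: drop (2 * k) s)].

Lemma dense_ge0 U (beta : R) : (0 < #|U|)%N -> dense adj U beta -> 0 <= beta.
Proof.
move=> U0 dU; have := dU x0; rewrite -ler_pdivrMr ?cardU_gt0 //; apply: le_trans.
by rewrite divr_ge0 // ler0n.
Qed.

Lemma adj_ok_lt z : symmetric adj ->
  (forall i j, (i < j)%N -> (j < size z)%N -> (j <= i + k)%N -> adj (nth x0 z i) (nth x0 z j)) ->
  adj_ok x0 adj k z.
Proof.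
move=> adjC H; apply/adj_okP => i j iz jz /and3P[ij ij1 ij2].
by have [lt|lt|E] := ltngtP i j; [apply: H| rewrite adjC; apply: H|nlia].
Qed.

(** Each entry is chosen adjacent to [v] and to the [k] entries before it. The templates without and
    with [v] share their variables, and half of the probability pays for the union bounds of
    both. *)
Lemma Pr_absorbs U v (beta e : R) : sparse_system adj bad nu ->
  (0 < #|U|)%N -> dense adj U beta -> nu <= e * #|U|%:R -> 1 <= e * #|U|%:R ->
  0 < 1 - k.+1%:R * beta ->
  (6 * (4 * k + 1) ^ 3)%:R * e <= (1 - k.+1%:R * beta) ^+ (4 * k) / 2 ->
  (1 - k.+1%:R * beta) ^+ (4 * k) / 2 <= Pr R U (4 * k) (fun s => uniq s && absorbs v s).
Proof.
move=> [adjC badC bad_o bad_c] U0 dU nue e1 rho0 small.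
set rho := 1 - _ in rho0 small *.
pose C p x := all (fun v => adj v x) (rcons (drop (size p - k) p) v).
have Hchain : rho ^+ (4 * k) <= Pr R U (4 * k) (chain C [::]).
  apply: Pr_chain => //; first exact: ltW.
  move=> p _; apply: le_trans (avg_common _ U0 dU).
  rewrite lerB // ler_wpM2r ?(dense_ge0 U0 dU) // ler_nat size_rcons size_drop; nlia.
pose sl1 : seq (slot V) := map inr (iota 0 (4 * k)).
pose sl2 : seq (slot V) := map inr (iota 0 (2 * k)) ++ inl v :: map inr (iota (2 * k) (2 * k)).
have f1 : free_slots sl1 = iota 0 (4 * k) by rewrite free_slots_free.
have f2 : free_slots sl2 = iota 0 (4 * k).
  rewrite free_slots_cat /= free_slots_free -/(free_slots _) free_slots_free.
  by rewrite -iotaD; congr iota; nlia.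
have s1 : size sl1 = (4 * k)%N by rewrite size_map size_iota.
have s2 : size sl2 = (4 * k + 1)%N.
  by rewrite size_cat /= !size_map !size_iota; nlia.
have ok1 : slots_ok x0 adj bad k sl1 (4 * k).
  split; rewrite ?f1 ?iota_uniq //; first by apply/allP => i; rewrite mem_iota.
  move=> i j l u w; rewrite s1 => iz jz lz tr.
  by rewrite (nth_map 0%N) ?size_iota.
have ok2 : slots_ok x0 adj bad k sl2 (4 * k).
  (* The middle entry [v] is the only root, so no triple has two outer roots. *)
  have rt i u : (i < 4 * k + 1)%N -> nth (inl x0) sl2 i = inl u -> i = (2 * k)%N.
    move=> i1; rewrite nth_cat size_map size_iota; case: ltnP => [i2|].
      by rewrite (nth_map 0%N) ?size_iota.
    rewrite leq_eqVlt => /orP[/eqP -> //|i2]; have -> : (i - 2 * k = (i - 2 * k).-1.+1)%N by nlia.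
    by rewrite /= (nth_map 0%N) ?size_iota //; nlia.
  split; rewrite ?f2 ?iota_uniq //; first by apply/allP => i; rewrite mem_iota.
  move=> i j l u w; rewrite s2 => iz jz lz tr /(rt _ _ iz) iE /(rt _ _ lz) lE.
  by move: tr; rewrite /triple iE lE eqxx !andbF.
have X0 : #|set0 : {set V}|%:R <= e * #|U|%:R by rewrite cards0 (le_trans ler01).
have := Pr_slots_good U0 badC bad_o bad_c (chain C [::]) ok1 nue e1 X0.
set P1 := (fun s => _ && _); rewrite s1 => H1.
have := Pr_slots_good U0 badC bad_o bad_c P1 ok2 nue e1 X0.
set P2 := (fun s => _ && _); rewrite s2 => H2.
have e0 : 0 <= e by rewrite -(pmulr_lge0 _ (cardU_gt0 R U0)) (le_trans ler01).
have sm : (3 * (4 * k) ^ 3)%:R * e <= (3 * (4 * k + 1) ^ 3)%:R * e.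
  by rewrite ler_wpM2r // ler_nat leq_mul2l leq_exp2r // leq_addr.
have sm2 : (6 * (4 * k + 1) ^ 3)%:R * e = (3 * (4 * k + 1) ^ 3)%:R * e + (3 * (4 * k + 1) ^ 3)%:R * e.
  by rewrite -mulrDl -natrD; congr (_%:R * _); nlia.
apply: le_trans (_ : _ <= Pr R U (4 * k) P2) _; first by lra.
apply: Pr_le => // s ss sU; rewrite /P2 /P1 => /andP[/andP[cs]].
rewrite /slots_good f1 => /and3P[t1 u1 _] /andP[t2 _].
have mapn : [seq nth x0 s p | p <- iota 0 (4 * k)] = s by rewrite -ss -/(mkseq _ _) mkseq_nth.
have E1 : map (interp x0 s) sl1 = s by rewrite -map_comp mapn.
have E2 : map (interp x0 s) sl2 = take (2 * k) s ++ v :: drop (2 * k) s.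
  rewrite map_cat /= -!map_comp; congr (_ ++ _ :: _).
    apply: (@eq_from_nth _ x0) => [|i]; rewrite size_map size_iota ?size_takel ?ss //; first by nlia.
    by move=> i2; rewrite (nth_map 0%N) ?size_iota // nth_iota // nth_take.
  apply: (@eq_from_nth _ x0) => [|i]; rewrite size_map size_iota ?size_drop ?ss //; first by nlia.
  by move=> i2; rewrite (nth_map 0%N) ?size_iota // nth_iota // nth_drop.
rewrite E1 in t1; rewrite E2 in t2; rewrite mapn in u1.
have adjs i j : (i < j)%N -> (j < 4 * k)%N -> (j <= i + k)%N -> adj (nth x0 s i) (nth x0 s j).
  move=> ij j4 jik; have := chainP x0 cs; rewrite ss => /(_ _ j4) /=.
  rewrite /C all_rcons size_takel ?ss // => [/andP[_ /allP]|]; last exact: ltnW.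
  apply; rewrite -(nth_take _ ij) -[i in nth _ _ i](subnKC (_ : j - k <= i)%N); last by nlia.
  by rewrite -nth_drop mem_nth // size_drop size_takel ?ss; nlia.
have adjv i : (i < 4 * k)%N -> adj v (nth x0 s i).
  by move=> i4; have := chainP x0 cs; rewrite ss => /(_ _ i4); rewrite /C all_rcons => /andP[].
rewrite u1 /absorbs ss eqxx /kpath t1 t2 !andbT /=; apply/andP; split.
  by apply: adj_ok_lt => // i j ij; rewrite ss; apply: adjs.
apply: adj_ok_lt => // i j ij; rewrite size_cat /= size_takel ?ss ?size_drop; last by nlia.
move=> jz jik; rewrite !nth_cat size_takel; last by nlia.
case: (ltnP j (2 * k)) => j1.
  by rewrite (ltn_trans ij j1) !nth_take //; [apply: adjs|]; nlia.
case: (ltnP i (2 * k)) => i1.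
  rewrite nth_take //; case jE: (j - 2 * k)%N => [|j'] /=.
    by rewrite adjC adjv //; nlia.
  by rewrite nth_drop; apply: adjs; nlia.
case iE: (i - 2 * k)%N => [|i'] /=; case jE: (j - 2 * k)%N => [|j'] /=; try nlia.
  by rewrite nth_drop adjv //; nlia.
by rewrite !nth_drop; apply: adjs; nlia.
Qed.

(** A random segment absorbs, in expectation, a fixed share of the total weight; some segment
    attains this. Its absorbed weight is positive, so it absorbs some vertex and is a path without
    repetitions. *)
Lemma absorber_exists U (q : V -> R) (beta e : R) : sparse_system adj bad nu ->
  (0 < #|U|)%N -> dense adj U beta -> nu <= e * #|U|%:R -> 1 <= e * #|U|%:R ->
  0 < 1 - k.+1%:R * beta ->
  (6 * (4 * k + 1) ^ 3)%:R * e <= (1 - k.+1%:R * beta) ^+ (4 * k) / 2 ->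
  (forall v, 0 < q v) ->
  exists s, [/\ size s = (4 * k)%N, uniq s, all (mem U) s, kpath s &
    (1 - k.+1%:R * beta) ^+ (4 * k) / 2 * \sum_v q v <= \sum_v q v * (absorbs v s)%:R].
Proof.
move=> sys U0 dU nue e1 rho0 small q0.
set c := _ / 2.
have c0 : 0 < c by rewrite divr_gt0 ?exprn_gt0.
have q_gt0 : 0 < \sum_v q v by rewrite (bigD1 x0) //= ltr_pwDl // sumr_ge0 // => v _; apply: ltW.
pose f s := \sum_v q v * (uniq s && absorbs v s)%:R.
have /(Em_exists U0)[s [ss sU fs]] : c * \sum_v q v <= Em U (4 * k) f.
  rewrite /f Em_sum mulr_sumr; apply: ler_sum => v _.
  rewrite EmZ mulrC ler_wpM2l ?(ltW (q0 v)) //; exact: (@Pr_absorbs U v beta e).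
have fs0 : 0 < f s by apply: lt_le_trans fs; rewrite mulr_gt0.
have [v /andP[us /and3P[_ ks _]]] : exists v, uniq s && absorbs v s.
  apply: contrapT => nex; move: fs0; rewrite /f big1 ?ltxx // => v _.
  by case h: (_ && _); [case: nex; exists v | rewrite mulr0].
exists s; split=> //; apply: le_trans fs _; rewrite /f.
by apply: ler_sum => w _; rewrite us.
Qed.
End Absorbers.

(** * Light segments *)

Section LightSegments.
Variables (R : realType) (V : finType) (x0 : V) (adj : rel V) (bad : V -> V -> V -> bool).
Variables (k : nat) (nu : R).
Implicit Types (U X : {set V}) (s z : seq V) (i j l : nat).
Local Notation kpath := (kpath x0 adj bad k).

Definition light_prob (xi : R) (N : nat) : R :=
  bu_bound (k.+1 * N) k.+1 ((xi / 4) ^+ k.+1).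

(** Sort [U] by weight; after the [r] lightest vertices come [k.+1] runs of length [b], and
    [theta i] is the least weight in run [i]. Enough vertices lie up to there to survive the loss of
    the non-neighbours of [i] vertices. As [theta i] is at most every weight in its run, [b] times
    the sum of the thresholds is at most the total weight. *)
Lemma thresholds_exist U (w : V -> R) (beta xi : R) : (0 < #|U|)%N ->
  (forall x, 0 <= w x) -> 0 < xi -> xi <= 1 -> k.+1%:R * beta * (1 + xi) <= 1 ->
  k.+1%:R <= xi / 4 * #|U|%:R ->
  exists theta : nat -> R,
    (forall i, (i <= k)%N -> xi / 4 + i%:R * beta <= avg U (fun x => (w x <= theta i)%R%:R)) /\
    \sum_(0 <= i < k.+1) theta i <= k.+1%:R * (1 + xi) * avg U w.
Proof.
move=> U0 w0 xi0 xi1 bxi Mbig; set M := #|U|%:R in Mbig.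
have M0 : 0 < M by rewrite ltr0n.
pose su := sort (fun x y => w x <= w y) (enum U).
have ssu : size su = #|U| by rewrite size_sort -cardE.
have wsort i j : (i <= j)%N -> (j < #|U|)%N -> w (nth x0 su i) <= w (nth x0 su j).
  move=> ij jU; pose rw : rel V := fun x y => w x <= w y.
  have tot : total rw by move=> x y; apply: le_total.
  have tr : transitive rw by move=> x y z; apply: le_trans.
  have rf : reflexive rw by move=> x; apply: lexx.
  apply: (sorted_leq_nth tr rf x0 (sort_sorted tot (enum U))) => //.
    by rewrite inE ssu (leq_ltn_trans ij).
  by rewrite inE ssu.
have sumE (f : V -> R) : \sum_(x in U) f x = \sum_(0 <= j < #|U|) f (nth x0 su j).
  rewrite -ssu -(big_nth x0 xpredT f) -[LHS]big_enum.
  by apply: perm_big; rewrite perm_sym perm_sort.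
(* This run length is at least [beta * M] by hypothesis, and it is short enough to leave [r] at
   least [xi / 4 * M]. *)
pose B := M / (k.+1%:R * (1 + xi)).
have k10 : 0 < k.+1%:R * (1 + xi) :> R by rewrite mulr_gt0 ?ltr0n // addr_gt0.
have B0 : 0 <= B by rewrite divr_ge0 ?ltW.
pose b := (Num.truncn B).+1.
have [bB Bb] : B <= b%:R /\ b%:R <= B + 1.
  have /andP[h1 h2] := truncn_itv B0; split; first exact: ltW.
  by rewrite /b -[(_).+1]addn1 natrD lerD2r.
have k1B : k.+1%:R * B = M / (1 + xi).
  by rewrite /B invfM mulrCA mulVKf // pnatr_eq0.
have Mxi : M / (1 + xi) <= M - xi / 2 * M.
  rewrite ler_pdivrMr ?addr_gt0 //.
  have -> : (M - xi / 2 * M) * (1 + xi) = M * (1 + xi * (1 - xi) / 2) by field.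
  apply: ler_peMr; first exact: ltW.
  have : 0 <= xi * (1 - xi) by apply: mulr_ge0; lra.
  by lra.
have kb : k.+1%:R * b%:R <= M - xi / 4 * M.
  apply: le_trans (_ : _ <= k.+1%:R * B + k.+1%:R) _; last by rewrite k1B; lra.
  by rewrite -[X in _ <= _ + X]mulr1 -mulrDr ler_wpM2l ?ler0n.
have kbU : (k.+1 * b <= #|U|)%N.
  rewrite -(ler_nat R) natrM (le_trans kb) // gerBl.
  by apply: mulr_ge0; lra.
pose r := (#|U| - k.+1 * b)%N.
have rM : xi / 4 * M <= r%:R by rewrite /r natrB // natrM -/M; lra.
have rE : (r + k.+1 * b = #|U|)%N by rewrite subnK.
pose theta i := w (nth x0 su (i * b + r)).
exists theta; split.
  move=> i ik.
  have iU : (i * b + r < #|U|)%N by rewrite -rE mulSn; nia.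
  rewrite /avg sumE ler_pdivlMr //.
  rewrite (big_cat_nat (n := (i * b + r).+1)) //=.
  have betaB : beta * M <= b%:R.
    apply: le_trans bB; rewrite /B ler_pdivlMr // mulrC mulrA -[leRHS]mul1r.
    by apply: ler_wpM2r; [exact: ltW | rewrite mulrAC].
  apply: le_trans (_ : _ <= \sum_(0 <= j < (i * b + r).+1) 1) _; last first.
    rewrite -[leLHS]addr0 lerD ?sumr_ge0 // ler_sum_nat //.
    by move=> j /andP[_ jb]; rewrite wsort.
  have -> : \sum_(0 <= j < (i * b + r).+1) 1 = i%:R * b%:R + r%:R + 1 :> R.
    by rewrite sumr_const_nat subn0 -[(_ + _).+1]addn1 !natrD natrM.
  rewrite mulrDl.
  have : i%:R * (beta * M) <= i%:R * b%:R by rewrite ler_wpM2l.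
  by rewrite mulrA; lra.
have sumc c : (c <= k.+1)%N ->
    b%:R * \sum_(0 <= i < c) theta i <= \sum_(0 <= j < r + c * b) w (nth x0 su j).
  elim: c => [_|c IH ck]; first by rewrite big_geq // mulr0 sumr_ge0.
  rewrite big_nat_recr //= mulrDr [leRHS](big_cat_nat (n := r + c * b)) ?leq_add2l ?leq_mul2r ?leqnSn ?orbT //=.
  apply: lerD; first by apply: IH; lia.
  have -> : b%:R * theta c = \sum_(r + c * b <= j < r + c.+1 * b) theta c.
    rewrite sumr_const_nat -[RHS]mulr_natl; congr (_%:R * _).
    by rewrite subnDl mulSn addnK.
  apply: ler_sum_nat => j /andP[j1 j2]; rewrite /theta addnC wsort //.
  rewrite -rE (leq_trans j2) // leq_add2l leq_mul2r ck orbT //.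
have := sumc k.+1 (leqnn _); rewrite rE -sumE => H.
rewrite /avg mulrA ler_pdivlMr //; set S := \sum_(x in U) w x in H *.
set T := \sum_(0 <= i < k.+1) theta i in H *.
have T0 : 0 <= T by apply: sumr_ge0 => i _; apply: w0.
apply: le_trans (ler_wpM2l (ltW k10) H).
rewrite [leRHS]mulrA [leLHS]mulrC; apply: ler_wpM2r => //.
by rewrite mulrC -ler_pdivrMr.
Qed.

(** Cliques whose [i]-th vertex has weight at most [theta i] are dense. The segment runs cyclically
    through the parts of a blow-up of such a clique: positions at distance at most [k] have
    different residues modulo [k.+1], hence are adjacent. *)
Lemma light_segment U (w : V -> R) (beta xi e : R) N : sparse_system adj bad nu ->
  (0 < #|U|)%N -> dense adj U beta -> nu <= e * #|U|%:R -> 1 <= e * #|U|%:R ->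
  (forall x, 0 <= w x) -> 0 < xi -> xi <= 1 -> k.+1%:R * beta * (1 + xi) <= 1 ->
  k.+1%:R <= xi / 4 * #|U|%:R -> (0 < N)%N ->
  (3 * (k.+1 * N) ^ 3)%:R * e < light_prob xi N ->
  exists s, [/\ size s = (k.+1 * N)%N, uniq s, all (mem U) s, kpath s &
    \sum_(x <- s) w x <= (k.+1 * N)%:R * (1 + xi) * avg U w].
Proof.
move=> [adjC badC bad_o bad_c] U0 dU nue e1 w0 xi0 xi1 bxi Mbig N0 small.
have [theta [thetaP theta_sum]] := thresholds_exist U0 w0 xi0 xi1 bxi Mbig.
set L := (k.+1 * N)%N in small *; have L0 : (0 < L)%N by rewrite muln_gt0.
pose C p x := all (fun v => adj v x) p && (w x <= theta (size p)).
have xi40 : 0 < xi / 4 by lra.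
have Hchain : (xi / 4) ^+ k.+1 <= Pr R U k.+1 (chain C [::]).
  apply: Pr_chain => //; first exact: ltW.
  move=> p; rewrite add0n ltnS => pk.
  have h1 := thetaP _ pk; have h2 := avg_common p U0 dU.
  have : avg U (fun x => (all (fun v => adj v x) p)%:R + (w x <= theta (size p))%R%:R - 1)
      <= avg U (fun x => (C p x)%:R) :> R.
    apply: avg_le => x _; rewrite /C.
    by case: (all _ _); case: (w x <= _) => /=; lra.
  rewrite !avgD (avg_const U0); lra.
have Hbu := Pr_blowup U0 L (exprn_gt0 k.+1 xi40) Hchain.
pose pos p := ((p %% k.+1) * L + p)%N.
pose sl : seq (slot V) := map inr (map pos (iota 0 L)).
have fsl : free_slots sl = map pos (iota 0 L) by rewrite free_slots_free.
have ssl : size sl = L by rewrite !size_map size_iota.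
have posm p : (p < L)%N -> (pos p < k.+1 * L)%N.
  by move=> pL; rewrite /pos; have : (p %% k.+1 < k.+1)%N by [rewrite ltn_pmod]; nnia.
have slok : slots_ok x0 adj bad k sl (k.+1 * L).
  split.
  - by rewrite fsl; apply/allP => _ /mapP[p + ->]; rewrite mem_iota; apply: posm.
  - rewrite fsl map_inj_in_uniq ?iota_uniq // => p q.
    rewrite !mem_iota /= => pl ql /(congr1 (modn^~ L)).
    by rewrite /pos !modnMDl !modn_small.
  - by move=> i j l u w'; rewrite ssl => iz jz lz tr; rewrite (nth_map 0%N) // size_map size_iota.
have X0 : #|set0 : {set V}|%:R <= e * #|U|%:R by rewrite cards0 (le_trans ler01).
have := Pr_slots_good U0 badC bad_o bad_c (bu L k.+1 (chain C [::])) slok nue e1 X0.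
set Good := (fun s => _ && _); rewrite ssl => HG.
have /(Pr_exists U0)[S [sS SU /andP[buS /and3P[tS uS _]]]] : 0 < Pr R U (k.+1 * L) Good.
  by apply: lt_le_trans HG; rewrite subr_gt0; apply: lt_le_trans Hbu.
pose c := mkseq (fun p => nth x0 S (pos p)) L.
have sc : size c = L by rewrite size_mkseq.
have cE : map (interp x0 S) sl = c by rewrite -!map_comp.
have cU : uniq c by move: uS; rewrite fsl -map_comp.
rewrite cE in tS.
have trans a b : (a < L)%N -> (b < L)%N -> (a %% k.+1 < b %% k.+1)%N ->
    adj (nth x0 c a) (nth x0 c b).
  move=> aL bL ab; pose sg i := if i == (a %% k.+1)%N then a else b.
  have sgL i : (i < k.+1)%N -> (sg i < L)%N by move=> _; rewrite /sg; case: ifP.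
  have := bu_transversal x0 sS sgL buS; set t := mkseq _ _ => ct.
  have bk : (b %% k.+1 < k.+1)%N by rewrite ltn_pmod.
  have ak : (a %% k.+1 < k.+1)%N by rewrite ltn_pmod.
  have := chainP x0 ct (_ : b %% k.+1 < size t)%N; rewrite size_mkseq => /(_ bk) /andP[/allP + _].
  have tk : size (take (b %% k.+1) t) = (b %% k.+1)%N by rewrite size_takel ?size_mkseq // ltnW.
  move=> /(_ (nth x0 t (a %% k.+1))); rewrite cat0s -(nth_take _ ab) mem_nth ?tk // => /(_ isT).
  rewrite nth_take // !nth_mkseq // /sg eqxx ifF //.
  by apply/negbTE; rewrite neq_ltn ab orbT.
have lightc p : (p < L)%N -> w (nth x0 c p) <= theta (p %% k.+1)%N.
  move=> pL; have sgL i : (i < k.+1)%N -> (p < L)%N by [].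
  have := bu_transversal x0 sS sgL buS; set t := mkseq _ _ => ct.
  have pk : (p %% k.+1 < k.+1)%N by rewrite ltn_pmod.
  have := chainP x0 ct (_ : p %% k.+1 < size t)%N; rewrite size_mkseq => /(_ pk) /andP[_].
  by rewrite cat0s size_takel ?size_mkseq 1?ltnW // !nth_mkseq.
exists c; split => //.
- apply/allP => _ /mapP[p + ->]; rewrite mem_iota /= => pL.
  by apply: (allP SU); rewrite mem_nth // sS posm.
- rewrite /kpath tS andbT; apply: adj_ok_lt => // i j ij; rewrite sc => jL jik.
  have [lt|lt|E] := ltngtP (i %% k.+1)%N (j %% k.+1)%N.
  + by apply: trans => //; apply: ltn_trans jL.
  + by rewrite adjC; apply: trans => //; apply: ltn_trans jL.
  + exfalso; have /eqP : (j = i %[mod k.+1])%N by rewrite E.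
    rewrite eqn_mod_dvd 1?ltnW // => /dvdn_leq; rewrite subn_gt0 => /(_ ij).
    nlia.
rewrite (big_nth x0) sc.
apply: le_trans (_ : \sum_(0 <= p < L) theta (p %% k.+1)%N <= _).
  by apply: ler_sum_nat => p /andP[_ pL]; apply: lightc.
have -> : \sum_(0 <= p < L) theta (p %% k.+1)%N = N%:R * \sum_(0 <= i < k.+1) theta i.
  rewrite /L; elim: (N) => [|n IH]; first by rewrite muln0 big_geq // mul0r.
  rewrite (big_cat_nat (n := (k.+1 * n)%N)) //= ?leq_mul2l ?leqnSn ?orbT // IH.
  rewrite -[n.+1]addn1 natrD mulrDl mul1r; congr (_ + _).
  rewrite -{1}[(k.+1 * n)%N]addn0 addn1 mulnS addnC big_addn addnK.
  by apply: eq_big_nat => i /andP[_ ik]; rewrite addnC mulnC modnMDl modn_small.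
apply: le_trans (ler_wpM2l (ler0n R N) theta_sum) _.
by rewrite le_eqVlt; apply/orP; left; apply/eqP; rewrite /L natrM; ring.
Qed.
End LightSegments.

(** * Growing the path *)

Section Growing.
Variables (R : realType) (V : finType) (x0 : V) (adj : rel V) (bad : V -> V -> V -> bool).
Variables (k : nat) (nu : R).
Implicit Types (U X : {set V}) (p s z : seq V) (bs : seq (seq V)) (i j l : nat).
Local Notation kpath := (kpath x0 adj bad k).
Local Notation absorbs := (absorbs x0 adj bad k).
Local Notation ell := (conn_len k).

(* [L0] bounds the length of every segment that is added in one step, and [u0]
   the number of vertices that are still unused. *)
Variables (beta e u0 : R) (L0 : nat).
Hypothesis sys : sparse_system adj bad nu.
Hypothesis k_gt0 : (0 < k)%N.
Hypothesis u0_gt0 : 0 < u0.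
Hypothesis e_ge0 : 0 <= e.
Hypothesis nu_le : nu <= e * u0.
Hypothesis L0_gt0 : (0 < L0)%N.
Hypothesis L0_le : L0%:R <= e * u0.
Hypothesis rho_gt0 : 0 < 1 - k.+1%:R * beta.
Hypothesis conn_small : (3 * (4 * k + ell) ^ 3)%:R * e < conn_prob k (1 - k.+1%:R * beta).

Lemma large_ample U : u0 <= #|U|%:R ->
  [/\ (0 < #|U|)%N, nu <= e * #|U|%:R, L0%:R <= e * #|U|%:R & 1 <= e * #|U|%:R].
Proof.
move=> uU; have H : e * u0 <= e * #|U|%:R by apply: ler_wpM2l.
have L1 : 1 <= L0%:R :> R by rewrite ler1n.
have LU := le_trans L0_le H; split=> //; last exact: le_trans LU.
  by rewrite -(ltr0n R); apply: lt_le_trans uU.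
exact: le_trans H.
Qed.

(** By [kpath_glue] the connector only has to fit the last [2 * k] vertices of [p] and the first
    [2 * k] of [s]. *)
Lemma extend U p s : u0 <= #|U|%:R -> dense adj U beta ->
  (2 * k <= size p)%N -> (2 * k <= size s)%N -> (size s <= L0)%N -> kpath p -> kpath s ->
  exists c, [/\ size c = ell, uniq c, all (mem U) c, all (fun x => x \notin s) c
    & kpath (p ++ c ++ s)].
Proof.
move=> uU dU sp ss sL kp ks; have [U0 nuU LU oneU] := large_ample uU.
pose p1 := take (size p - 2 * k) p; pose Q := drop (size p - 2 * k) p.
pose R2 := take (2 * k) s; pose s1 := drop (2 * k) s.
have pE : p = p1 ++ Q by rewrite cat_take_drop.
have sE : s = R2 ++ s1 by rewrite cat_take_drop.
have sQ : size Q = (2 * k)%N by rewrite size_drop subKn.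
have sR : size R2 = (2 * k)%N by rewrite size_takel.
have kQ : kpath Q by move: kp; rewrite {1}pE => /kpath_suffix.
have kR : kpath R2 by move: ks; rewrite {1}sE => /kpath_prefix.
have Xs : #|[set x in s]|%:R <= e * #|U|%:R.
  apply: le_trans LU; rewrite ler_nat; apply: leq_trans sL.
  by rewrite cardsE card_size.
have [c [sc uc cU cX kc]] := connect_roots sys k_gt0 U0 dU nuU oneU Xs rho_gt0 conn_small sQ sR kQ kR.
exists c; split => //; first by apply: sub_all cX => x; rewrite inE.
have h1 : kpath (p1 ++ Q ++ (c ++ R2)) by apply: kpath_glue; rewrite ?sQ // -pE.
have h2 : kpath ((p1 ++ Q ++ c) ++ R2 ++ s1).
  by apply: kpath_glue; rewrite ?sR -?sE // -!catA.
by rewrite sE pE -!catA; rewrite -!catA in h2.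
Qed.

Definition rest p : {set V} := ~: [set x in p].

Lemma card_rest p : uniq p -> #|rest p| = (#|V| - size p)%N.
Proof. by move=> up; rewrite cardsCs setCK cardsE (card_uniqP up). Qed.

Lemma all_rest p s : all (mem (rest p)) s = ~~ has (mem p) s.
Proof. by rewrite -all_predC; apply: eq_all => x; rewrite /= !inE. Qed.

Lemma uniq_extend p c s : uniq p -> uniq c -> uniq s -> all (mem (rest p)) c ->
  all (mem (rest p)) s -> all (fun x => x \notin s) c -> uniq (p ++ c ++ s).
Proof.
move=> up uc us; rewrite !all_rest => cp sp cs.
rewrite !cat_uniq up uc us has_cat negb_or cp sp /= andbT.
by rewrite has_sym -all_predC.
Qed.

Lemma dense_rest p (beta0 tau : R) : uniq p -> 0 <= beta0 ->
  dense adj [set: V] beta0 -> (size p)%:R <= tau * #|V|%:R -> 0 <= beta ->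
  beta0 <= beta * (1 - tau) -> dense adj (rest p) beta.
Proof.
move=> up b0 d0 sp b1 bb v.
apply: le_trans (_ : #|[set x in [set: V] | ~~ adj v x]|%:R <= _).
  by rewrite ler_nat subset_leq_card //; apply/subsetP => x; rewrite !inE => /andP[_ ->].
apply: le_trans (d0 v) _; rewrite cardsT card_rest //.
apply: le_trans (ler_wpM2r (ler0n _ _) bb) _; rewrite -mulrA ler_wpM2l //.
have spV : (size p <= #|V|)%N by rewrite -(card_uniqP up) max_card.
by rewrite natrB // mulrBl mul1r lerB.
Qed.

(** Each new segment comes from [absorber_exists] with the current terms of the sum as weights. With
    [rho] as in the proof, it halves terms of total weight at least [rho / 2] of the sum, which
    shrinks by the factor [1 - rho / 4]. The list [bs] keeps segments and connectors as separate
    entries, ready for insertion. *)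
Lemma absorbing_path (beta0 tau : R) J :
  dense adj [set: V] beta0 -> 0 <= beta0 -> beta0 <= beta * (1 - tau) -> 0 <= beta ->
  (4 * k <= L0)%N -> (6 * (4 * k + 1) ^ 3)%:R * e <= (1 - k.+1%:R * beta) ^+ (4 * k) / 2 ->
  (4 * k + J * (ell + 4 * k))%:R <= tau * #|V|%:R -> u0 <= (1 - tau) * #|V|%:R ->
  exists bs, [/\ kpath (flatten bs), uniq (flatten bs),
    size (flatten bs) = (4 * k + J * (ell + 4 * k))%N &
    \sum_v (1 / 2) ^+ count (absorbs v) bs <=
      #|V|%:R * (1 - (1 - k.+1%:R * beta) ^+ (4 * k) / 4) ^+ J].
Proof.
move=> d0 b00 bt b0 kL small.
set rho := (1 - k.+1%:R * beta) ^+ (4 * k) in small *.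
have r0 : 0 < rho by rewrite exprn_gt0.
have r1 : rho <= 1.
  by apply: exprn_ile1; [exact: ltW | rewrite gerBl mulr_ge0].
have half n : 0 < (1 / 2) ^+ n :> R by apply: exprn_gt0; lra.
have usable p : uniq p -> (size p)%:R <= tau * #|V|%:R -> u0 <= (1 - tau) * #|V|%:R ->
    u0 <= #|rest p|%:R /\ dense adj (rest p) beta.
  move=> up sp uV; split; last exact: dense_rest bt.
  have spV : (size p <= #|V|)%N by rewrite -(card_uniqP up) max_card.
  by rewrite card_rest // natrB //; lra.
have absorber p (q : V -> R) : u0 <= #|rest p|%:R -> dense adj (rest p) beta ->
    (forall v, 0 < q v) ->
    exists s, [/\ size s = (4 * k)%N, uniq s, all (mem (rest p)) s, kpath s &
    rho / 2 * \sum_v q v <= \sum_v q v * (absorbs v s)%:R].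
  move=> uU dU q0; have [U0 nuU LU oneU] := large_ample uU.
  have h := absorber_exists x0 sys U0 dU nuU oneU rho_gt0 small q0; exact: h.
move=> + uV; elim: J => [|J IH] sJ.
  have [uU dU] : u0 <= #|rest [::]|%:R /\ dense adj (rest [::]) beta.
    by apply: usable => //; apply: le_trans sJ; rewrite ler_nat.
  have [s [ss us sU ks _]] := absorber [::] (fun=> 1) uU dU (fun=> ltr01).
  exists [:: s]; rewrite /= cats0 ss expr0 mulr1; split => //; first by rewrite mul0n addn0.
  rewrite -sum1_card natr_sum; apply: ler_sum => v _.
  by apply: exprn_ile1; lra.
have [|bs [kb ub sb potb]] := IH.
  by apply: le_trans sJ; rewrite ler_nat mulSn; nlia.
have sbV : (size (flatten bs))%:R <= tau * #|V|%:R.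
  by apply: le_trans sJ; rewrite ler_nat sb mulSn; nlia.
have [uU dU] := usable _ ub sbV uV.
pose q v : R := (1 / 2) ^+ count (absorbs v) bs.
have [s [ss us sU ks sq]] := absorber _ q uU dU (fun v => half _).
have [c [sc uc cU cs kc]] : exists c, [/\ size c = ell, uniq c, all (mem (rest (flatten bs))) c,
    all (fun x => x \notin s) c & kpath (flatten bs ++ c ++ s)].
  by apply: extend => //; rewrite ?sb ?ss //; nlia.
exists (bs ++ [:: c; s]); rewrite flatten_cat /= cats0; split => //.
- exact: uniq_extend.
- by rewrite !size_cat sb sc ss mulSn; nlia.
apply: le_trans (_ : \sum_v (q v - q v * (absorbs v s)%:R / 2) <= _).
  apply: ler_sum => v _; rewrite count_cat /= addn0 exprD -/(q v).
  rewrite -mulrA -[X in X - _]mulr1 -mulrBr ler_wpM2l ?(ltW (half _)) // exprD.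
  (* Should the connector itself absorb [v], the term only gets smaller. *)
  have h : (1 / 2) ^+ absorbs v c <= 1 :> R by apply: exprn_ile1; lra.
  by case: (absorbs v s); rewrite /= ?expr0 ?expr1; lra.
rewrite sumrB -mulr_suml -/(\sum_v q v).
apply: le_trans (_ : (\sum_v q v) * (1 - rho / 4) <= _); first lra.
by rewrite exprSr mulrA ler_wpM2r //; lra.
Qed.
End Growing.

(** * Elementary bounds on the exponential function *)

Section ExpBounds.
Variable R : realType.
Implicit Types y : R.

(** Inverting [1 - y <= expR (- y)] bounds the exponential by 1/(1 - y). *)
Lemma expR_le_quadratic y : `|y| <= 1 / 2 -> expR y <= 1 + y + 2 * y ^+ 2.
Proof.
rewrite ler_norml => /andP[y1 y2].
have h := expR_ge1Dx (- y); rewrite expRN in h.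
have E0 := expR_gt0 y.
have {}h : (1 - y) * expR y <= 1 by rewrite -ler_pdivlMr // div1r.
have {}h : expR y <= (1 - y)^-1 by rewrite -div1r ler_pdivlMr ?(mulrC (expR y)) //; lra.
apply: le_trans h _; rewrite -div1r ler_pdivrMr; last by lra.
have -> : (1 + y + 2 * y ^+ 2) * (1 - y) = 1 + y ^+ 2 * (1 - 2 * y) by ring.
by rewrite lerDl mulr_ge0 ?sqr_ge0 //; lra.
Qed.

Lemma mul_expR_ge y : expR y - 1 <= y * expR y.
Proof.
have := expR_ge1Dx (- y); rewrite expRN -(ler_pM2r (expR_gt0 y)) mulVf ?gt_eqF ?expR_gt0 //.
by rewrite mulrDl mul1r mulNr; lra.
Qed.

Lemma expR_gt_sqr y : 0 <= y -> y ^+ 2 / 4 < expR y.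
Proof.
move=> y0; have -> : expR y = expR (y / 2) ^+ 2.
  by rewrite expr2 -expRD; congr expR; lra.
have h := expR_ge1Dx (y / 2).
apply: lt_le_trans (_ : (1 + y / 2) ^+ 2 <= _).
  have -> : (1 + y / 2) ^+ 2 = y ^+ 2 / 4 + (1 + y) by field.
  by rewrite ltrDl; lra.
by rewrite lerXn2r // nnegrE; lra.
Qed.
End ExpBounds.

(** * Covering by multiplicative weights *)

Section Covering.
Variables (R : realType) (V : finType) (x0 : V) (adj : rel V) (bad : V -> V -> V -> bool).
Variables (k : nat) (nu : R).
Implicit Types (U X : {set V}) (p s z : seq V) (i j l : nat).
Local Notation kpath := (kpath x0 adj bad k).
Local Notation ell := (conn_len k).
Local Notation n := #|V|%:R.
Local Notation nonadj U v := #|[set x in U | ~~ adj v x]|.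

Variables (beta e u0 a b lam xi : R) (L0 N : nat).
Local Notation L := (ell + k.+1 * N)%N.
Hypothesis sys : sparse_system adj bad nu.
Hypothesis k_gt0 : (0 < k)%N.
Hypothesis u0_gt0 : 0 < u0.
Hypothesis e_ge0 : 0 <= e.
Hypothesis nu_le : nu <= e * u0.
Hypothesis L0_gt0 : (0 < L0)%N.
Hypothesis L0_le : L0%:R <= e * u0.
Hypothesis rho_gt0 : 0 < 1 - k.+1%:R * beta.
Hypothesis conn_small : (3 * (4 * k + ell) ^ 3)%:R * e < conn_prob k (1 - k.+1%:R * beta).
Hypothesis N2 : (1 < N)%N.
Hypothesis N_le : (k.+1 * N <= L0)%N.
Hypothesis xi_gt0 : 0 < xi.
Hypothesis xi_le1 : xi <= 1.
Hypothesis beta_xi : k.+1%:R * beta * (1 + xi) <= 1.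
Hypothesis u0_xi : k.+1%:R <= xi / 4 * u0.
Hypothesis light_small : (3 * (k.+1 * N) ^ 3)%:R * e < light_prob k xi N.
Hypothesis lam_gt0 : 0 < lam.
Hypothesis lam_L : lam * L%:R <= 1 / 2.
Hypothesis a_ge0 : 0 <= a.
Hypothesis a_le1 : a <= 1.
Hypothesis b_ge0 : 0 <= b.
(** The summands are the second-order error of the exponential, the cost of the connector, and the
    gain from the light segment when [xi < b]. *)
Hypothesis drift : 2 * lam * L%:R ^+ 2 + a * ell%:R + (k.+1 * N)%:R * (xi - b) <= 0.
Hypothesis a_b_beta : 2 * b * n <= (beta - a) * u0.
Hypothesis a_le_beta : a <= beta.
Hypothesis n_big : 2 * n <= expR (lam * (b * n)).

Definition excess U v : R := (nonadj U v)%:R - a * #|U|%:R - b * n.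
Definition potential U : R := \sum_v expR (lam * excess U v).

(** A single term stays below [expR (lam * (b * n))], so every excess is below [b * n]; the total
    slack [2 * b * n] fits between [a] and [beta]. *)
Lemma dense_of_potential U : u0 <= #|U|%:R -> potential U < 2 * n -> dense adj U beta.
Proof.
move=> uU pot v; have hv : expR (lam * excess U v) < expR (lam * (b * n)).
  apply: lt_le_trans n_big; apply: le_lt_trans pot.
  by rewrite /potential (bigD1 v) //= lerDl sumr_ge0 // => w _; apply/ltW/expR_gt0.
move: hv; rewrite ltr_expR ltr_pM2l // /excess => hv.
have h : (beta - a) * u0 <= (beta - a) * #|U|%:R by rewrite ler_wpM2l // subr_ge0.
by rewrite -(subrK a beta) mulrDl; move: hv h a_b_beta; lra.
Qed.

Lemma card_adj U v : \sum_(x in U) (adj v x)%:R = #|U|%:R - (nonadj U v)%:R :> R.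
Proof.
rewrite -(cardsID [set x | adj v x] U) natrD.
have -> : U :\: [set x | adj v x] = [set x in U | ~~ adj v x].
  by apply/setP => x; rewrite !inE andbC.
rewrite addrK -sum1_card natr_sum [RHS]big_mkcond [LHS]big_mkcond /=.
by apply: eq_bigr => x _; rewrite !inE; case: (x \in U); case: (adj v x).
Qed.

Lemma rest_cat p s : rest (p ++ s) = rest p :\: [set x in s].
Proof. by apply/setP => x; rewrite !inE mem_cat negb_or andbC. Qed.

Lemma nonadj_rest_cat p s v : uniq s -> all (mem (rest p)) s ->
  (nonadj (rest (p ++ s)) v)%:R =
    (nonadj (rest p) v)%:R - \sum_(x <- s) (~~ adj v x)%:R :> R.
Proof.
move=> us sp; apply/eqP; rewrite eq_sym subr_eq; apply/eqP.
rewrite -(cardsID [set x in s] [set x in rest p | ~~ adj v x]) natrD addrC; congr (_ + _).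
  by congr (_%:R); apply: eq_card => x; rewrite rest_cat !inE andbA.
rewrite big_mkcond -natr_sum; congr (_%:R).
rewrite -big_mkcond sum1_count -size_filter -(card_uniqP (filter_uniq _ us)).
apply: eq_card => x; rewrite !inE mem_filter; case xs: (x \in s); last by rewrite !andbF.
by have := allP sp x xs; rewrite /= !inE => ->; rewrite andbT.
Qed.

Lemma size_rest p : uniq p -> #|rest p|%:R = n - (size p)%:R :> R.
Proof.
by move=> up; rewrite card_rest // natrB // -(card_uniqP up) max_card.
Qed.

(** A step changes each exponent by at most 1/2, so a potential below [n] at most doubles. From [n]
    upwards the weighted mean excess is nonnegative, so the average of [w] is at most [1 - a - b]; a
    segment that is light for [w] uses up enough weighted non-neighbours to keep the potential from
    growing. *)
Lemma potential_step p : kpath p -> uniq p -> (2 * k <= size p)%N ->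
  u0 <= #|rest p|%:R -> potential (rest p) < 2 * n ->
  exists t, [/\ size t = L, kpath (p ++ t), uniq (p ++ t) &
    potential (rest (p ++ t)) < 2 * n].
Proof.
move=> kp up sp uU pot; set U := rest p in uU pot *.
have dU := dense_of_potential uU pot.
have [U0 nuU LU oneU] := large_ample u0_gt0 e_ge0 nu_le L0_gt0 L0_le uU.
pose W v := expR (lam * excess U v).
have W0 v : 0 < W v by apply: expR_gt0.
set Phi := potential U in pot.
have PhiE : Phi = \sum_v W v by [].
have Phi0 : 0 < Phi.
  by rewrite PhiE (bigD1 x0) //= ltr_pwDl // sumr_ge0 // => v _; apply: ltW.
(* The share of the potential carried by the neighbours of [x]. *)
pose w x := (\sum_v W v * (adj v x)%:R) / Phi.
have w0 x : 0 <= w x.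
  apply: divr_ge0; last exact: ltW.
  by apply: sumr_ge0 => v _; apply: mulr_ge0; [exact: ltW | exact: ler0n].
have w1 x : w x <= 1.
  rewrite /w ler_pdivrMr // mul1r PhiE; apply: ler_sum => v _.
  by case: (adj v x); rewrite ?mulr1 // mulr0 ltW.
have xiU : k.+1%:R <= xi / 4 * #|U|%:R.
  by apply: le_trans u0_xi _; rewrite ler_pM2l // divr_gt0.
have [s [ss us sU ks sw]] := light_segment x0 sys U0 dU nuU oneU w0 xi_gt0 xi_le1 beta_xi
  xiU (ltnW N2) light_small.
have s2 : (2 * k <= size s)%N by rewrite ss; nnia.
have sL : (size s <= L0)%N by rewrite ss.
have [c [sc uc cU cs kc]] := extend sys k_gt0 u0_gt0 e_ge0 nu_le L0_gt0 L0_le rho_gt0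
  conn_small uU dU sp s2 sL kp ks.
have ut : uniq (c ++ s) by rewrite cat_uniq uc us andbT /= has_sym -all_predC.
have tU : all (mem U) (c ++ s) by rewrite all_cat cU sU.
exists (c ++ s); split => //.
- by rewrite size_cat sc ss.
- exact: uniq_extend.
set t := c ++ s in ut tU *.
have st : size t = L by rewrite size_cat sc ss.
pose d v : R := \sum_(x <- t) (~~ adj v x)%:R.
pose T := \sum_(x <- t) w x.
have sum1 (r : seq V) : \sum_(x <- r) 1 = (size r)%:R :> R.
  by elim: r => [|x r IH]; rewrite ?big_nil // big_cons IH /= -[(size r).+1]add1n natrD.
have dE v : d v = L%:R - \sum_(x <- t) (adj v x)%:R.
  rewrite -st -sum1 -sumrB; apply: eq_bigr => x _.
  by case: (adj v x); rewrite /= ?subrr ?subr0.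
have d0 v : 0 <= d v by apply: sumr_ge0 => x _; apply: ler0n.
have dL v : d v <= L%:R by rewrite dE gerBl; apply: sumr_ge0 => x _; apply: ler0n.
(* The change of the exponent: the allowance [a * #|U|] shrinks by [a * L], while [d v]
   non-neighbours are used up. *)
pose y v := lam * (a * L%:R - d v).
have excE v : lam * excess (rest (p ++ t)) v = lam * excess U v + y v.
  rewrite /excess /y nonadj_rest_cat // -/U -/(d v) (size_rest (uniq_extend _ _ _ _ _ _)) //.
  by rewrite (size_rest up) size_cat natrD st; ring.
have aL : 0 <= a * L%:R <= L%:R.
  by rewrite mulr_ge0 //= ler_piMl.
have yl v : `|y v| <= lam * L%:R.
  rewrite /y normrM (gtr0_norm lam_gt0) ler_pM2l // ler_norml.
  by have := d0 v; have := dL v; move: aL => /andP[]; lra.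
have y2 v : y v ^+ 2 <= lam ^+ 2 * L%:R ^+ 2.
  rewrite -exprMn -real_normK ?num_real // lerXn2r ?nnegrE // ?normr_ge0 //.
  by rewrite mulr_ge0 // ltW.
have yh v : `|y v| <= 1 / 2 by apply: le_trans lam_L.
have newE : potential (rest (p ++ t)) = \sum_v W v * expR (y v).
  by apply: eq_bigr => v _; rewrite excE expRD.
have [Phin|Phin] := ltP Phi n.
  apply: le_lt_trans (_ : 2 * Phi < _); last by rewrite ltr_pM2l.
  rewrite newE PhiE mulr_sumr; apply: ler_sum => v _.
  rewrite mulrC ler_wpM2r ?(ltW (W0 v)) //; apply: le_trans (expR_le_quadratic (yh v)) _.
  have := yh v; rewrite ler_norml => /andP[h1 h2].
  have : (1 / 2 - y v) * (1 / 2 + y v) >= 0 by apply: mulr_ge0; lra.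
  by rewrite expr2; lra.
apply: le_lt_trans pot.
(* By [mul_expR_ge], each term times [lam] is at least [W v - 1], and these sum to [Phi - n]. *)
have WX : 0 <= \sum_v W v * excess U v.
  rewrite -(pmulr_rge0 _ lam_gt0) mulr_sumr.
  apply: le_trans (_ : \sum_v (W v - 1) <= _); last first.
    apply: ler_sum => v _; apply: le_trans (mul_expR_ge _) _.
    by rewrite mulrCA mulrC.
  by rewrite sumrB -PhiE sumr_const subr_ge0.
set M : R := #|U|%:R in uU xiU *.
have M0 : 0 < M by rewrite ltr0n.
have Mn : M <= n by rewrite ler_nat max_card.
have WD : (a * M + b * n) * Phi <= \sum_v W v * (nonadj U v)%:R.
  have -> : \sum_v W v * (nonadj U v)%:R =
      \sum_v W v * excess U v + \sum_v W v * (a * M + b * n).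
    by rewrite -big_split; apply: eq_bigr => v _; rewrite /excess -/M /=; ring.
  by rewrite -mulr_suml -PhiE mulrC lerDr.
have avgw : avg U w <= 1 - a - b.
  have sw_ : (\sum_(x in U) w x) * Phi = M * Phi - \sum_v W v * (nonadj U v)%:R.
    rewrite mulr_suml PhiE mulr_sumr -sumrB.
    transitivity (\sum_(x in U) \sum_v W v * (adj v x)%:R).
      by apply: eq_bigr => x _; rewrite /w divfK // gt_eqF.
    rewrite exchange_big; apply: eq_bigr => v _.
    by rewrite -mulr_sumr card_adj -/M; ring.
  rewrite /avg -/M ler_pdivrMr // -(ler_pM2r Phi0) sw_.
  have : b * M * Phi <= b * n * Phi by rewrite ler_wpM2r ?(ltW Phi0) // ler_wpM2l.
  by move: WD; rewrite mulrDl; lra.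
(* The connector is not chosen for its weight, so its vertices are charged the maximum 1. *)
have TB : T <= ell%:R + (k.+1 * N)%:R * (1 - a - b + xi).
  rewrite /T /t big_cat /=; apply: lerD.
    by rewrite -sc -sum1; apply: ler_sum.
  apply: le_trans sw _; rewrite -mulrA ler_wpM2l //.
  have aw0 : 0 <= avg U w by rewrite divr_ge0 // sumr_ge0.
  have aw1 : avg U w <= 1 by rewrite -[leRHS](avg_const U0); apply: avg_le.
  have : xi * avg U w <= xi * 1 by rewrite ler_wpM2l // ltW.
  by rewrite mulrDl mul1r mulr1; lra.
have WT : \sum_v W v * d v = Phi * (L%:R - T).
  rewrite mulrBr.
  have -> : Phi * T = \sum_v W v * \sum_(x <- t) (adj v x)%:R.
    rewrite /T mulr_sumr; under [RHS]eq_bigr do rewrite mulr_sumr.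
    rewrite exchange_big; apply: eq_bigr => x _; rewrite /w mulrC divfK //.
    by rewrite gt_eqF.
  by rewrite {1}PhiE mulr_suml -sumrB; apply: eq_bigr => v _; rewrite dE mulrBr.
rewrite newE.
apply: le_trans (_ : \sum_v (W v * (1 + 2 * (lam ^+ 2 * L%:R ^+ 2) + lam * (a * L%:R))
    - lam * (W v * d v)) <= _).
  apply: ler_sum => v _.
  have -> : lam * (W v * d v) = W v * (lam * d v) by ring.
  rewrite -mulrBr ler_wpM2l ?(ltW (W0 v)) //.
  apply: le_trans (expR_le_quadratic (yh v)) _.
  have := y2 v; rewrite {2}/y mulrBr; lra.
rewrite sumrB -mulr_suml -mulr_sumr -PhiE WT.
have -> : Phi * (1 + 2 * (lam ^+ 2 * L%:R ^+ 2) + lam * (a * L%:R)) - lam * (Phi * (L%:R - T)) =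
   Phi + Phi * lam * (2 * lam * L%:R ^+ 2 + a * L%:R - L%:R + T) by ring.
rewrite gerDl; apply: mulr_ge0_le0; first by apply: mulr_ge0; exact: ltW.
apply: le_trans drift; rewrite natrD mulrDr in TB *.
lra.
Qed.

Lemma covering_path p j : kpath p -> uniq p -> (2 * k <= size p)%N ->
  (forall v, (nonadj (rest p) v)%:R <= a * #|rest p|%:R + b * n) ->
  u0 + (size p + j * L)%:R <= n ->
  exists t, [/\ size t = (j * L)%N, kpath (p ++ t), uniq (p ++ t) &
    dense adj (rest (p ++ t)) beta].
Proof.
move=> kp up sp dp0.
have n0 : 0 < n :> R by rewrite ltr0n; apply/card_gt0P; exists x0.
suff H : u0 + (size p + j * L)%:R <= n -> exists t, [/\ size t = (j * L)%N, kpath (p ++ t),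
    uniq (p ++ t) & potential (rest (p ++ t)) < 2 * n].
  move=> un; have [t [st kt ut pt]] := H un; exists t; split => //.
  apply: dense_of_potential => //; rewrite size_rest // size_cat st.
  by rewrite lerBrDr.
elim: j => [|j IH] un.
  exists [::]; rewrite cats0; split => //.
  apply: le_lt_trans (_ : n < _); last by rewrite ltr_pMl // ltr1n.
  rewrite -sum1_card natr_sum; apply: ler_sum => v _; rewrite -expR0 ler_expR.
  rewrite pmulr_rle0 // /excess; have := dp0 v; lra.
have un' : u0 + (size p + j * L)%:R <= n.
  by apply: le_trans un; rewrite lerD2l ler_nat mulSn; nlia.
have [t [st kt ut pt]] := IH un'.
have uU : u0 <= #|rest (p ++ t)|%:R by rewrite size_rest // size_cat st lerBrDr.
have [|t' [st' kt' ut' pt']] := potential_step kt ut _ uU pt.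
  by rewrite size_cat; nlia.
by exists (t ++ t'); rewrite catA size_cat st st' mulSn addnC.
Qed.
End Covering.

(** * Absorption and choice of constants *)

Section Absorption.
Variables (V : finType) (x0 : V) (adj : rel V) (bad : V -> V -> V -> bool) (k : nat).
Implicit Types (z s : seq V) (vs : seq V) (bs : seq (seq V)).
Local Notation kpath := (kpath x0 adj bad k).
Local Notation absorbs := (absorbs x0 adj bad k).

(* The wrapped part makes the cyclic conditions linear ones. *)
Definition closed z := kpath (z ++ take (2 * k) z).

(** The first half of [B] has length [2 * k], so the wrapped prefix ends before [v] and does not
    change; [kpath_glue] on both sides of [v] does the rest. *)
Lemma closed_insert s1 s2 v B : absorbs v B -> closed (s1 ++ B ++ s2) ->
  closed (s1 ++ (take (2 * k) B ++ v :: drop (2 * k) B) ++ s2).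
Proof.
case/and3P => /eqP sB kB; set A1 := take _ _; set A2 := drop _ _ => kA.
have BE : B = A1 ++ A2 by rewrite cat_take_drop.
have s1A : size A1 = (2 * k)%N by rewrite size_takel // sB; lia.
have s2A : size A2 = (2 * k)%N by rewrite size_drop sB; lia.
have wrap (r : seq V) : take (2 * k) (s1 ++ A1 ++ r) = take (2 * k) (s1 ++ A1).
  by rewrite catA takel_cat // size_cat s1A; lia.
rewrite /closed BE -!catA !wrap; set wr := take _ _ => kz.
have k1 : kpath (s1 ++ A1 ++ (v :: A2)).
  apply: kpath_glue; rewrite ?s1A //.
  by move: kz; rewrite catA => /kpath_prefix.
have k2 : kpath (A2 ++ (s2 ++ wr)).
  by move: kz; rewrite catA => /kpath_suffix.
have := @kpath_glue _ x0 adj bad k (s1 ++ A1 ++ [:: v]) A2 (s2 ++ wr).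
by rewrite s2A -!catA; apply.
Qed.

(** Greedy insertion: each step alters one block, so every other vertex loses at most one absorber
    while one vertex fewer remains. *)
Lemma absorb_all vs bs : closed (flatten bs) ->
  (forall v, v \in vs -> (size vs <= count (absorbs v) bs)%N) ->
  exists2 z, perm_eq z (flatten bs ++ vs) & closed z.
Proof.
elim: vs bs => [|v vs IH] bs cb cnt; first by exists (flatten bs); rewrite ?cats0.
have : has (absorbs v) bs by rewrite has_count; apply: leq_trans (cnt v (mem_head _ _)).
move=> /hasP[B Bbs vB]; case/splitPr: Bbs cb cnt => [b1 b2] cb cnt.
set B' := take (2 * k) B ++ v :: drop (2 * k) B.
have [||z zE cz] := IH (b1 ++ B' :: b2).
- by move: cb; rewrite !flatten_cat /=; apply: closed_insert.
- move=> u uvs; have := cnt u; rewrite inE uvs orbT => /(_ isT).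
  by rewrite !count_cat /=; case: (absorbs u B) => /=; lia.
exists z => //; apply: perm_trans zE _; rewrite !flatten_cat /= -!catA perm_cat2l.
rewrite /B' -[in X in perm_eq _ X](cat_take_drop (2 * k) B) -!catA perm_cat2l /=.
by rewrite perm_sym catA -(cat1s v vs) perm_catCA /= -catA.
Qed.
End Absorption.

(** * A closed spanning path *)

Section Spanning.
Variables (R : realType) (V : finType) (x0 : V) (adj : rel V) (bad : V -> V -> V -> bool).
Variables (k : nat) (nu : R).
Local Notation kpath := (kpath x0 adj bad k).
Local Notation ell := (conn_len k).
Local Notation n := #|V|%:R.

Lemma spanning_closed (beta0 beta tau e u0 a b lam xi : R) (L0 N J h E : nat) :
  let L := (ell + k.+1 * N)%N in let rho := 1 - k.+1%:R * beta in
  sparse_system adj bad nu -> dense adj [set: V] beta0 -> (0 < k)%N ->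
  0 <= beta0 -> beta0 <= beta * (1 - tau) -> beta0 <= a * (1 - tau) ->
  0 < u0 -> u0 <= (1 - tau) * n -> 0 <= e -> nu <= e * u0 ->
  (0 < L0)%N -> L0%:R <= e * u0 -> (4 * k <= L0)%N -> (k.+1 * N <= L0)%N -> (1 < N)%N ->
  0 < rho -> (3 * (4 * k + ell) ^ 3)%:R * e < conn_prob k rho ->
  (6 * (4 * k + 1) ^ 3)%:R * e <= rho ^+ (4 * k) / 2 ->
  (3 * (k.+1 * N) ^ 3)%:R * e < light_prob k xi N ->
  0 < xi -> xi <= 1 -> k.+1%:R * beta * (1 + xi) <= 1 -> k.+1%:R <= xi / 4 * u0 ->
  0 < lam -> lam * L%:R <= 1 / 2 -> 0 <= a -> a <= 1 -> 0 <= b -> a <= beta ->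
  2 * lam * L%:R ^+ 2 + a * ell%:R + (k.+1 * N)%:R * (xi - b) <= 0 ->
  2 * b * n <= (beta - a) * u0 -> 2 * n <= expR (lam * (b * n)) ->
  (4 * k + J * (ell + 4 * k))%:R <= tau * n ->
  n * (1 - rho ^+ (4 * k) / 4) ^+ J <= (1 / 2) ^+ h ->
  u0 <= E%:R -> (E + L <= h)%N ->
  exists z, [/\ uniq z, forall x, x \in z & closed x0 adj bad k z].
Proof.
move=> L rho sys d0 k0 b00 b0b b0a u00 u0n e0 nue L00 L0e kL NL N2 rho0 conn_s abs_s light_s
  xi0 xi1 bxi u0xi lam0 lamL a0 a1 b0 ab drift abu nbig sJ pot uE EL.
have beta_ge0 : 0 <= beta by apply: le_trans ab.
have [bs [kb ub sb potb]] := absorbing_path x0 sys k0 u00 e0 nue L00 L0e rho0 conn_s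
  d0 b00 b0b beta_ge0 kL abs_s sJ u0n.
set p1 := flatten bs in kb ub sb.
have sp1 : (size p1 <= #|V|)%N by rewrite -(card_uniqP ub) max_card.
have s1n : (size p1)%:R <= tau * n by rewrite sb.
have s1k : (2 * k <= size p1)%N by rewrite sb; nlia.
have d1 v : #|[set x in rest p1 | ~~ adj v x]|%:R <= a * #|rest p1|%:R + b * n.
  have d0a : dense adj (rest p1) a.
    have := @dense_rest R V adj a p1 beta0 tau ub b00 d0 s1n a0 b0a; exact.
  by apply: le_trans (d0a v) _; rewrite lerDl mulr_ge0.
pose j := ((#|V| - size p1 - E) %/ L)%N.
have L_gt0 : (0 < L)%N by rewrite /L; nnia.
have jL : (j * L <= #|V| - size p1 - E)%N by apply: leq_divM.
have jL2 : (#|V| - size p1 - E < j.+1 * L)%N by apply: ltn_ceil.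
have un : u0 + (size p1 + j * L)%:R <= n.
  have [EV|VE] := leqP E (#|V| - size p1).
    apply: le_trans (_ : E%:R + (size p1 + j * L)%:R <= n); first by rewrite lerD2r.
    by rewrite -natrD ler_nat; nlia.
  have -> : (j * L = 0)%N by nlia.
  rewrite addn0; apply: le_trans (lerD u0n s1n) _.
  by rewrite mulrBl mul1r subrK.
have [t [st kt ut dt]] := covering_path sys k0 u00 e0 nue L00 L0e rho0 conn_s N2 NL xi0 xi1
  bxi u0xi light_s lam0 lamL a0 a1 b0 drift abu ab nbig kb ub s1k d1 un.
set p := p1 ++ t in kt ut dt.
have sp : size p = (size p1 + j * L)%N by rewrite size_cat st.
have pk : (2 * k <= size p)%N by rewrite sp; nlia.
have uU : u0 <= #|rest p|%:R by rewrite size_rest // sp lerBrDr.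
have st2 : size (take (2 * k) p) = (2 * k)%N by rewrite size_takel.
have kt2 : kpath (take (2 * k) p) by move: kt; rewrite -{1}(cat_take_drop (2 * k) p) => /kpath_prefix.
(* The path is closed by connecting its end to its own first [2 * k] vertices. *)
have [||c [sc uc cU _ kc]] := extend sys k0 u00 e0 nue L00 L0e rho0 conn_s uU dt pk _ _ kt kt2.
- by rewrite st2.
- by rewrite st2; nlia.
have upc : uniq (p ++ c) by rewrite cat_uniq ut uc andbT -all_rest.
pose bs' := bs ++ [:: t; c].
have fE : flatten bs' = p ++ c by rewrite flatten_cat /= cats0 /p catA.
have cl : closed x0 adj bad k (flatten bs').
  by rewrite /closed fE takel_cat // -catA.
pose vs := enum (rest (p ++ c)).
have svs : (size vs <= h)%N.
  by rewrite -cardE card_rest // size_cat sp; nlia.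
have [v|z zE cz] := @absorb_all V x0 adj bad k vs bs' cl.
  move=> _; apply: leq_trans svs _; rewrite count_cat; apply: leq_trans (leq_addr _ _).
  rewrite leqNgt; apply/negP => lt.
  (* One vertex with fewer than [h] absorbers would alone push the sum in [potb] above
     [(1 / 2) ^+ h]. *)
  have : (1 / 2) ^+ h < (1 / 2) ^+ count (absorbs x0 adj bad k v) bs :> R.
    by rewrite ltr_iXn2l //; lra.
  rewrite ltNge; apply/negP; rewrite negbK; apply: le_trans pot.
  apply: le_trans potb; rewrite (bigD1 v) //= lerDl sumr_ge0 // => w _.
  by apply: exprn_ge0; lra.
exists z; split => //.
  rewrite (perm_uniq zE) fE cat_uniq upc enum_uniq andbT -all_rest.
  by apply/allP => x; rewrite mem_enum.
move=> x; rewrite (perm_mem zE) fE mem_cat mem_enum !inE; exact: orbN.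
Qed.
End Spanning.

(** * Choice of constants *)

Section Constants.
Variable R : realType.

(** A form of Bernoulli's inequality, [H], applied with [q] such that [q * (1 - x)] is at least
    3. *)
Lemma exprn_small (x : R) : 0 <= x -> x < 1 -> exists q, x ^+ q <= 1 / 4.
Proof.
move=> x0 x1; pose y := 1 - x; have y0 : 0 < y by rewrite subr_gt0.
have H q : x ^+ q * (1 + q%:R * y) <= 1.
  elim: q => [|q IH]; first by rewrite expr0 mul1r mul0r addr0.
  apply: le_trans IH; rewrite exprSr -mulrA ler_wpM2l ?exprn_ge0 //.
  rewrite -[q.+1]addn1 natrD mulrDl mul1r.
  have -> : x = 1 - y by rewrite /y subKr.
  have : 0 <= q%:R * y ^+ 2 by rewrite mulr_ge0 // exprn_ge0 // ltW.
  have : 0 <= y ^+ 2 by rewrite exprn_ge0 // ltW.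
  have -> : (1 - y) * (1 + (q%:R * y + y)) = 1 + q%:R * y - q%:R * y ^+ 2 - y ^+ 2 by ring.
  by lra.
exists (Num.truncn (3 / y)).+1; set q := _.+1.
have qy : 3 <= q%:R * y by rewrite -ler_pdivrMr // ltW // truncnS_gt.
have := H q; have x_0 : 0 <= x ^+ q by apply: exprn_ge0.
have : x ^+ q * 4 <= x ^+ q * (1 + q%:R * y) by rewrite ler_wpM2l //; lra.
by lra.
Qed.

Lemma linear_le_exp2 (C h : nat) : (4 * C <= h -> h.+1 * C <= 2 ^ h)%N.
Proof.
move=> Ch; pose m := h./2.
have hm : (h <= m.*2.+1)%N by rewrite -[leqLHS]odd_double_half /m; case: (odd h); lia.
have m2 : (m.*2 <= h)%N by rewrite /m -[leqRHS]odd_double_half leq_addl.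
have m_lt : (m.+1 <= 2 ^ m)%N by apply: ltn_expl.
have : (2 ^ m * 2 ^ m <= 2 ^ h)%N by rewrite -expnD addnn leq_pexp2l.
have : (m.+1 * m.+1 <= 2 ^ m * 2 ^ m)%N by apply: leq_mul.
have : (2 * C <= m.+1)%N by lia.
move=> c1; have : (m.+1 * (2 * C) <= m.+1 * m.+1)%N by rewrite leq_mul2l c1 orbT.
have : (h.+1 * C <= (2 * m.+1) * C)%N by rewrite leq_mul2r; lia.
nia.
Qed.

Lemma le_truncnS (x : R) : x <= (Num.truncn x).+1%:R.
Proof. by apply/ltW/truncnS_gt. Qed.

Theorem closed_kpath_exists (k : nat) (g : R) : (0 < k)%N -> 0 < g -> g <= 1 / (2 * k.+1%:R) ->
  exists2 nu : R, 0 < nu & exists n0 : nat,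
    forall (V : finType) (x0 : V) (adj : rel V) (bad : V -> V -> V -> bool),
      (n0 <= #|V|)%N -> sparse_system adj bad (nu * #|V|%:R) ->
      dense adj [set: V] (1 / k.+1%:R - g) ->
      exists z, [/\ uniq z, forall x, x \in z & closed x0 adj bad k z].
Proof.
move=> k0 g0 gk; set ell := conn_len k; set K := k.+1%:R in gk *.
have K2 : 2 <= K by rewrite (ler_nat R 2).
have K0 : 0 < K by lra.
pose i := 1 / K.
have Ki : K * i = 1 by rewrite /i mulrC divfK // gt_eqF.
have i0 : 0 < i by rewrite divr_gt0.
have i1 : i <= 1 / 2 by rewrite /i ler_pdivrMr //; lra.
have gi : g <= i / 2.
  by apply: le_trans gk _; rewrite /i !div1r invfM mulrC.
rewrite -/i.
(* The order is [beta0 < a < beta < i]: the first gap pays for the absorbing path, the second for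
   the slack of the covering, and the third makes [rho] positive. *)
pose beta0 := i - g; pose beta := i - g / 2; pose a := i - 3 * g / 4; pose tau := g / 4.
pose rho := 1 - K * beta.
have rhoE : rho = K * g / 2 by rewrite /rho /beta mulrBr Ki; lra.
have rho0 : 0 < rho by rewrite rhoE divr_gt0 // mulr_gt0.
have grho : g <= rho.
  have : 2 * g <= K * g by rewrite ler_wpM2r // ltW.
  by rewrite rhoE; lra.
have rho1 : rho <= 1.
  have : K * g <= K * (i / 2) by rewrite ler_wpM2l // ltW.
  by rewrite mulrA Ki rhoE; lra.
set r4 := rho ^+ (4 * k).
have r40 : 0 < r4 by rewrite exprn_gt0.
have r41 : r4 <= 1 by apply: exprn_ile1; lra.
(* Every [q] absorbing segments quarter the sum of absorber weights, so [q * h] of them bring it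
   from [n <= 2 ^+ h] down to [(1 / 2) ^+ h]. *)
have [||q qE] := @exprn_small (1 - r4 / 4); [lra|lra|].
have tau0 : 0 < tau by rewrite /tau; lra.
(* With [h] about [n / C], the [q * h] absorbing segments and their connectors occupy at most
   [tau / 2 * n] vertices. *)
pose C := (Num.truncn (2 * (q * (ell + 4 * k))%:R / tau)).+1.
have CE : (q * (ell + 4 * k))%:R <= C%:R * (tau / 2).
  have := le_truncnS (2 * (q * (ell + 4 * k))%:R / tau).
  by rewrite ler_pdivrMr // -/C; lra.
have Cpos : (0 < C)%N by [].
clearbody C.
have C0 : 0 < C%:R :> R by rewrite ltr0n.
(* For [u0 = n / (4 * C)] this makes [2 * b * n] equal to [(beta - a) * u0]. *)
pose b := g / (32 * C%:R).
have b0 : 0 < b by rewrite divr_gt0 // mulr_gt0.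
have bg : b <= g.
  rewrite /b ler_pdivrMr ?mulr_gt0 // ler_peMr ?ltW //.
  have : 1 <= C%:R :> R by rewrite ler1n.
  by lra.
pose xi := b / 2.
(* The light segment outweighs the connector: as [lam] makes the second-order term 1, the drift is
   at most [ell + 1 - k.+1 * N * b / 2]. *)
pose N := (Num.truncn (2 * ell.+1%:R / b)).+2.
have Nb : ell.+1%:R <= (k.+1 * N)%:R * (b / 2).
  have h1 : 2 * ell.+1%:R / b <= N%:R.
    by apply: le_trans (le_truncnS _) _; rewrite ler_nat.
  have h2 : N%:R <= (k.+1 * N)%:R :> R by rewrite ler_nat leq_pmull.
  by have := le_trans h1 h2; rewrite ler_pdivrMr //; lra.
have N2 : (1 < N)%N by [].
clearbody N.
pose L := (ell + k.+1 * N)%N.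
have L1 : 1 <= L%:R :> R by rewrite ler1n /L addn_gt0 muln_gt0 (ltnW N2) orbT.
have L0' : 0 < L%:R :> R by lra.
pose lam : R := 1 / (2 * L%:R ^+ 2).
have lam0 : 0 < lam by rewrite divr_gt0 // mulr_gt0 // exprn_gt0.
have lamL2 : 2 * lam * L%:R ^+ 2 = 1.
  by rewrite mulrAC /lam mulrC divfK // mulf_neq0 // ?expf_neq0 // gt_eqF.
have lamL : lam * L%:R <= 1 / 2.
  have : lam * L%:R * 1 <= lam * L%:R * L%:R by rewrite ler_wpM2l // mulr_ge0 // ltW.
  by rewrite mulr1 -mulrA -expr2; lra.
pose L0 := (4 * k + k.+1 * N)%N.
pose A1 := (3 * (4 * k + ell) ^ 3)%N; pose A2 := (6 * (4 * k + 1) ^ 3)%N.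
pose A3 := (3 * (k.+1 * N) ^ 3)%N.
have cp0 : 0 < conn_prob k rho by rewrite bu_bound_gt0 // exprn_gt0.
have xi0 : 0 < xi by rewrite /xi; lra.
have lp0 : 0 < light_prob k xi N by rewrite bu_bound_gt0 // exprn_gt0 // divr_gt0.
have small_exists (y : R) (A : nat) : 0 < y -> 0 < y / A.+1%:R /\
    forall e, 0 <= e -> e <= y / A.+1%:R -> A%:R * e < y.
  move=> y0; split=> [|e e0]; first by rewrite divr_gt0.
  rewrite ler_pdivlMr // => h; have [->|en] := eqVneq e 0; first by rewrite mulr0.
  apply: lt_le_trans h; rewrite mulrC ltr_pM2l ?ltr_nat //.
  by rewrite lt_def en.
have [e1p e1P] := small_exists _ A1 cp0.
have [e2p e2P] := small_exists (r4 / 2) A2 (divr_gt0 r40 (ltr0n _ 2)).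
have [e3p e3P] := small_exists _ A3 lp0.
pose e := Num.min (conn_prob k rho / A1.+1%:R) (Num.min (r4 / 2 / A2.+1%:R) (light_prob k xi N / A3.+1%:R)).
have e0 : 0 < e by rewrite !lt_min e1p e2p e3p.
have [e1 e2 e3] : [/\ A1%:R * e < conn_prob k rho, A2%:R * e < r4 / 2 & A3%:R * e < light_prob k xi N].
  have e_ge0 := ltW e0.
  by split; [apply: e1P|apply: e2P|apply: e3P] => //; rewrite /e !ge_min lexx ?orbT.
clearbody e.
(* Chosen so that [nu * n = e * u0]. *)
exists (e / (4 * C%:R)); first by rewrite divr_gt0 // mulr_gt0.
(* Lower bounds on [n]: [x1] makes [4 * k] at most [tau / 2 * n], [x2] gives [L0 <= e * u0], [x3]
   gives [k.+1 <= xi / 4 * u0], and [x4] makes the exponential exceed [2 * n]. The last summand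
   below makes [h] large against [C] and [L]. *)
pose x1 : R := 8 * k%:R / tau; pose x2 := 4 * C%:R * L0%:R / e.
pose x3 := 16 * C%:R * K / xi; pose x4 := 8 / (lam * b) ^+ 2.
exists ((Num.truncn x1).+1 + (Num.truncn x2).+1 + (Num.truncn x3).+1 + (Num.truncn x4).+1
  + C * (4 * C + 2 * L.+1))%N.
move=> V x0 adj bad Vbig sys d0.
have big (x : R) (m : nat) : (m <= #|V|)%N -> (Num.truncn x < m)%N -> x <= #|V|%:R.
  move=> mV xm; apply: le_trans (le_truncnS x) _; rewrite ler_nat; exact: leq_trans xm mV.
have [n1 n2 n3 n4] : [/\ x1 <= #|V|%:R, x2 <= #|V|%:R, x3 <= #|V|%:R & x4 <= #|V|%:R].
  by split; apply: big Vbig _; nlia.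
have n5 : (C * (4 * C + 2 * L.+1) <= #|V|)%N by nlia.
set n : R := #|V|%:R in n1 n2 n3 n4 sys.
have n0 : 0 < n.
  apply: lt_le_trans n2; apply: divr_gt0 => //; apply: mulr_gt0; first exact: mulr_gt0.
  by rewrite ltr0n /L0 addn_gt0 muln_gt0 k0.
pose h := (#|V| %/ C)%N; pose E := (#|V| %/ (C * 4)).+1.
have hC : (h * C <= #|V|)%N by apply: leq_divM.
have h_big : (4 * C + 2 * L.+1 <= h)%N by rewrite leq_divRL // mulnC.
have EL : (E + L <= h)%N.
  rewrite /E divnMA -/h; have := leq_divM h 4; clearbody h; move: h_big; clear.
  by lia.
pose u0 := n / (4 * C%:R).
have C40 : 0 < 4 * C%:R :> R by rewrite mulr_gt0.
have uE : u0 <= E%:R.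
  rewrite /u0 ler_pdivrMr // -natrM -natrM ler_nat ltnW //.
  by rewrite [(4 * C)%N]mulnC; apply: ltn_ceil; rewrite muln_gt0 Cpos.
have hCn : h%:R * C%:R <= n by rewrite -natrM ler_nat.
have Cu : 4 * C%:R * u0 = n by rewrite /u0 mulrC divfK // gt_eqF.
have u00 : 0 < u0 by apply: divr_gt0.
have C1 : 1 <= C%:R :> R by rewrite ler1n.
have g4 : g <= 1 / 4 by lra.
have bE : b * (32 * C%:R) = g by rewrite /b divfK // gt_eqF // mulr_gt0.
have nlt : n <= 2 ^+ h.
  rewrite -natrX ler_nat; apply: leq_trans (linear_le_exp2 (leq_trans (leq_addr _ _) h_big)).
  by apply/ltnW/ltn_ceil.
clear Vbig big n5 h_big small_exists e1P e2P e3P e1p e2p e3p cp0 lp0.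
apply: (@spanning_closed R V x0 adj bad k (e / (4 * C%:R) * n) beta0 beta tau e u0 a b lam xi L0 N
  (q * h) h E) => //; rewrite -/ell -/L -/K -/rho -/r4 -/n.
- by rewrite /beta0; lra.
- have : tau * beta <= tau * 1 by apply: ler_wpM2l; [exact: ltW | rewrite /beta; lra].
  by rewrite mulrBr !mulr1 (mulrC beta) /beta0 /beta /tau; lra.
- have : tau * a <= tau * 1 by apply: ler_wpM2l; [exact: ltW | rewrite /a; lra].
  by rewrite mulrBr !mulr1 (mulrC a) /beta0 /a /tau; lra.
- have : 1 * u0 <= C%:R * u0 by apply: ler_wpM2r => //; exact: ltW.
  have : tau * n <= 1 / 4 * n by apply: ler_wpM2r; [exact: ltW | rewrite /tau; lra].
  by move: Cu n0; rewrite mulrBl !mul1r -mulrA; lra.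
- exact: ltW.
- by rewrite /u0 mulrA mulrAC.
- by rewrite /L0 addn_gt0 muln_gt0 k0.
- rewrite -(ler_pM2l C40) mulrCA Cu -ler_pdivrMl // mulrC; exact: n2.
- exact: leq_addr.
- exact: leq_addl.
- exact: ltW.
- by rewrite /xi; lra.
- have -> : K * beta = 1 - rho by rewrite /rho subKr.
  have : 0 <= rho * xi by apply: mulr_ge0; exact: ltW.
  have : xi <= rho by rewrite /xi; move: grho bg b0; lra.
  rewrite mulrDr mulr1 [_ * xi in X in _ -> _ -> X]mulrBl mul1r.
  by clearbody rho xi; move: (rho * xi) => y; lra.
- have : 16 * C%:R * K <= xi * n by move: n3; rewrite /x3 ler_pdivrMr // [n * _]mulrC.
  have gen (c K' x u : R) : 16 * c * K' <= x * (4 * c * u) -> 4 * c * K' <= 4 * c * (x / 4 * u).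
    by lra.
  by rewrite -Cu => h3; rewrite -(ler_pM2l C40); apply: gen.
- by rewrite /a; lra.
- by rewrite /a; lra.
- exact: ltW.
- by rewrite /a /beta; lra.
- rewrite lamL2; have : a * ell%:R <= 1 * ell%:R.
    by apply: ler_wpM2r => //; rewrite /a; lra.
  have -> : xi - b = - (b / 2) by rewrite /xi; lra.
  by move: Nb; rewrite -[ell.+1]addn1 natrD mulrN mul1r; lra.
- have -> : beta - a = g / 4 by rewrite /beta /a; lra.
  by rewrite le_eqVlt; apply/orP; left; apply/eqP; rewrite -Cu -bE; field.
- have y0 : 0 <= lam * (b * n) by apply: mulr_ge0; [|apply: mulr_ge0]; exact: ltW.
  apply: (le_trans _ (ltW (expR_gt_sqr y0))).
  have lb : 0 < (lam * b) ^+ 2 by rewrite exprn_gt0 // mulr_gt0.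
  have : 8 * n <= n * (lam * b) ^+ 2 * n.
    by rewrite ler_pM2r //; move: n4; rewrite /x4 ler_pdivrMr.
  have -> : n * (lam * b) ^+ 2 * n = (lam * (b * n)) ^+ 2 by ring.
  by lra.
- have h1 : 8 * k%:R <= n * tau by move: n1; rewrite /x1 ler_pdivrMr.
  have h2 : h%:R * (q * (ell + 4 * k))%:R <= h%:R * (C%:R * (tau / 2)) by rewrite ler_wpM2l.
  have h3 : h%:R * C%:R * (tau / 2) <= n * (tau / 2) by rewrite ler_wpM2r //; lra.
  rewrite mulnAC natrD [(_ * h)%:R]natrM natrM.
  by move: h1 h2 h3; rewrite mulrA; lra.
- rewrite exprM; apply: le_trans (_ : n * ((1 / 4) ^+ h) <= _).
    rewrite ler_wpM2l ?(ltW n0) // lerXn2r ?nnegrE //; last by lra.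
    by apply: exprn_ge0; lra.
  have -> : (1 / 4 : R) = 1 / 2 * (1 / 2) by lra.
  have p2 : 0 < (1 / 2) ^+ h :> R by apply: exprn_gt0; lra.
  rewrite exprMn mulrA -[leRHS]mul1r ler_wpM2r ?(ltW p2) //.
  by rewrite div1r exprVn ler_pdivrMr ?exprn_gt0 // mul1r.
Qed.
End Constants.

(** * From cyclic sequences to graphs *)

Section CyclicToGraph.
Variables (V : finType) (x0 : V) (adj' : rel V) (bad : V -> V -> V -> bool) (k : nat) (z : seq V).
Hypothesis z_uniq : uniq z.
Hypothesis z_all : forall x, x \in z.
Hypothesis z_closed : closed x0 adj' bad k z.
Hypothesis z_size : (2 * k + 2 < size z)%N.
Local Notation m := (size z).

Definition cyc_nth i := nth x0 z (i %% m).

Let m_gt0 : (0 < m)%N. Proof. by lia. Qed.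

Lemma cyc_nth_next x : next z x = cyc_nth (index x z).+1.
Proof.
rewrite next_nth z_all /cyc_nth; have : (index x z < m)%N by rewrite index_mem z_all.
case: {+}z => // y s /=; set i := index _ _; rewrite ltnS leq_eqVlt => /orP[/eqP->|is_].
  by rewrite modnn nth_default.
by rewrite modn_small //=; apply: set_nth_default.
Qed.

Lemma index_cyc_nth i : index (cyc_nth i) z = (i %% m)%N.
Proof. by rewrite index_uniq // ltn_pmod. Qed.

Lemma cyc_nth_index x : cyc_nth (index x z) = x.
Proof. by rewrite /cyc_nth modn_small ?index_mem ?nth_index. Qed.

Definition cyc_rel x y := (next z x == y) || (next z y == x).

Lemma cyc_rel_sym : symmetric cyc_rel.
Proof. by move=> x y; rewrite /cyc_rel orbC. Qed.

Lemma cyc_rel_irr : irreflexive cyc_rel.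
Proof.
move=> x; rewrite /cyc_rel orbb; apply/negbTE/eqP => /(congr1 (index^~ z)).
rewrite cyc_nth_next index_cyc_nth; have : (index x z < m)%N by rewrite index_mem z_all.
rewrite leq_eqVlt => /orP[/eqP E|lt]; first by rewrite E modnn; lia.
by rewrite modn_small //; lia.
Qed.

Definition cyc_graph := SGraph cyc_rel_sym cyc_rel_irr.

Lemma cyc_graph_hamilton : is_hamilton_cycle cyc_graph.
Proof. by exists z; split => //; lia. Qed.

Lemma dist_le_sym d x y : dist_le cyc_graph d x y -> dist_le cyc_graph d y x.
Proof.
case=> p [xp yE sp]; exists (rev (belast x p)); split; last by rewrite size_rev size_belast.
  by rewrite -yE rev_path; apply: sub_path xp => u v /=; rewrite cyc_rel_sym.
by case: p yE {xp sp} => [|u p] //= yE; rewrite rev_cons last_rcons.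
Qed.

Definition power_rel x y := `[< x != y /\ dist_le cyc_graph k x y >].

Lemma power_rel_sym : symmetric power_rel.
Proof.
move=> x y; apply/asboolP/asboolP => -[xy /dist_le_sym d];
  by split=> //; rewrite eq_sym.
Qed.

Lemma power_rel_irr : irreflexive power_rel.
Proof. by move=> x; apply/asboolP => -[]; rewrite eqxx. Qed.

Definition power_graph := SGraph power_rel_sym power_rel_irr.

Lemma power_graph_hamilton : is_hamilton_power k power_graph.
Proof.
by exists cyc_graph; [exact: cyc_graph_hamilton | move=> x y; split=> /asboolP].
Qed.

(** [a] counts the backward and [b] the forward steps; the congruence is additive to avoid truncated
    subtraction. *)
Lemma path_shift x p : path cyc_rel x p -> exists a b, (a + b = size p)%N /\
  (index (last x p) z + a = index x z + b %[mod m])%N.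
Proof.
elim: p x => [|y p IH] x /=; first by exists 0%N, 0%N.
case/andP => xy /IH[a [b [ab E]]].
case/orP: xy => /eqP h; move/(congr1 (index^~ z)): (esym h); rewrite cyc_nth_next index_cyc_nth => hh.
  exists a, b.+1; split; first by rewrite addnS ab.
  by rewrite E hh modnDml addSnnS.
exists a.+1, b; split; first by rewrite addSn ab.
by rewrite hh modnDml addnS -addn1 -modnDml E modnDml addn1 addSn.
Qed.

(** Such a [c] has [k] positions on either side within the wrapped word, so all neighbours of [x] in
    the power appear around one occurrence of [x], and adjacency and badness can be read off
    there. *)
Lemma power_rel_pos x y c : power_rel x y -> (k <= c < m + k)%N -> cyc_nth c = x ->
  exists P, [/\ (P < m + 2 * k)%N, near k P c & cyc_nth P = y].
Proof.
move=> /asboolP[xy [p [xp yE sp]]] /andP[kc cm] cx.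
have [a [b [ab E]]] := path_shift xp; rewrite yE -cx index_cyc_nth modnDml in E.
have [ak bk] : (a <= k)%N /\ (b <= k)%N.
  by split; apply: leq_trans sp; rewrite -ab ?leq_addl ?leq_addr.
clear ab xp sp.
have yP P : (index y z = P %[mod m])%N -> cyc_nth P = y.
  by move=> E'; rewrite /cyc_nth -E' -[RHS]cyc_nth_index.
have neqc P : cyc_nth P = y -> P != c.
  by move=> Py; apply/eqP => Pc; move: xy; rewrite -cx -Py Pc eqxx.
have [le|lt] := leqP a b.
  have Py : cyc_nth (c + (b - a)) = y.
    apply: yP; apply/eqP; rewrite -(eqn_modDr a) E; apply/eqP; congr (_ %% _)%N; lia.
  exists (c + (b - a))%N; split => //; first by lia.
  by rewrite /near neqc //; lia.
have Py : cyc_nth (c - (a - b)) = y.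
  apply: yP; apply/eqP; rewrite -(eqn_modDr a) E; apply/eqP; congr (_ %% _)%N; lia.
exists (c - (a - b))%N; split => //; first by lia.
by rewrite /near neqc //; lia.
Qed.

Lemma cyc_nthE P : (P < m + 2 * k)%N -> nth x0 (z ++ take (2 * k) z) P = cyc_nth P.
Proof.
move=> Pm; rewrite nth_cat /cyc_nth; case: ltnP => [lt|mP]; first by rewrite modn_small.
have -> : (P %% m = P - m)%N.
  by rewrite -{1}(subnK mP) modnDr modn_small //; lia.
by rewrite nth_take //; lia.
Qed.

Lemma centre_pos x : exists2 c, (k <= c < m + k)%N & cyc_nth c = x.
Proof.
have im : (index x z < m)%N by rewrite index_mem z_all.
have [ik|ki] := ltnP (index x z) k.
  exists (index x z + m)%N; first by lia.
  by rewrite /cyc_nth modnDr -/(cyc_nth _) cyc_nth_index.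
by exists (index x z); [lia | exact: cyc_nth_index].
Qed.

Let size_wrap : size (z ++ take (2 * k) z) = (m + 2 * k)%N.
Proof. by rewrite size_cat size_takel //; lia. Qed.

Lemma power_adj x y : symmetric adj' -> power_rel x y -> adj' x y.
Proof.
move=> adjC xy; have [c cm cx] := centre_pos x.
have [P [Pm Pc Py]] := power_rel_pos xy cm cx.
case/andP: z_closed => /adj_okP A _; rewrite adjC -cx -Py -!cyc_nthE //; last by lia.
by apply: A => //; rewrite size_wrap //; lia.
Qed.

Lemma power_not_bad x y w : power_rel x y -> power_rel x w -> y != w -> ~~ bad y x w.
Proof.
move=> xy xw yw; have [c cm cx] := centre_pos x.
have [P [Pm Pc Py]] := power_rel_pos xy cm cx.
have [Q [Qm Qc Qw]] := power_rel_pos xw cm cx.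
have PQ : P != Q by apply/eqP => E; move: yw; rewrite -Py -Qw E eqxx.
case/andP: z_closed => _ /tri_okP T; rewrite -cx -Py -Qw -!cyc_nthE //; last by lia.
by apply: T; rewrite ?size_wrap // /triple ?Pc ?Qc //; lia.
Qed.
End CyclicToGraph.

(** * Incompatibility as a ternary relation on vertices *)

Section Systems.
Variables (V : finType) (G : sgraph V) (F : incompat_system G).

Lemma mem_edges (H : sgraph V) a b : ([set a; b] \in edges H) = adj H a b.
Proof.
apply/imsetP/idP => [[[u v]]|ab]; last by exists (a, b); rewrite ?inE.
rewrite inE /= => uv /setP E.
have := E a; have := E b; have := E u; have := E v; rewrite !inE !eqxx /= ?orbT.
have vu : v != u by apply: contraTneq uv => ->; rewrite adj_irr.
case: (eqVneq v a) => [va|_] /=.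
  case: (eqVneq u a) => [ua|_] /=; first by rewrite va ua eqxx in vu.
  by move=> _ /eqP<- _ _; rewrite -va adj_sym.
move=> /eqP<-; case: (eqVneq u a) => [<- //|_] /= /eqP uv'.
by rewrite uv' eqxx in vu.
Qed.

Definition bad_at u v w := [set [set v; u]; [set v; w]] \in F v.

Lemma bad_atC u v w : bad_at u v w = bad_at w v u.
Proof. by rewrite /bad_at setUC. Qed.

Lemma bad_atP u v w : bad_at u v w -> [/\ adj G v u, adj G v w & [set v; u] != [set v; w]].
Proof.
case/incompat_atP => e [e' [eE eE' ne _ E]].
have inE' f : f \in [set [set v; u]; [set v; w]] -> f \in edges G.
  by rewrite E !inE => /orP[] /eqP->.
split; rewrite -?mem_edges.
- by apply: inE'; rewrite set21.
- by apply: inE'; rewrite set22.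
apply: contraNneq ne => E1; rewrite E1 setUid in E.
have : e \in [set e; e'] by rewrite set21.
have : e' \in [set e; e'] by rewrite set22.
by rewrite -E !inE => /eqP-> /eqP->.
Qed.

(** If some [w] is bad, then {v, u} is an edge and its bound carries over along the injective map
    from [w] to {v, w}; otherwise the count is 0. *)
Lemma bad_at_bounded (R : realType) (D : R) u v : 0 <= D -> bounded_system F D ->
  #|[set w | bad_at u v w]|%:R <= D.
Proof.
move=> D0 bF; have [w0 w0B|none] := pickP (bad_at u v); last first.
  by rewrite (_ : [set w | _] = set0) ?cards0 //; apply/setP => w; rewrite !inE none.
have [vu _ _] := bad_atP w0B.
have e_edge : [set v; u] \in edges G by rewrite mem_edges.
apply: le_trans (bF v [set v; u] e_edge (set21 _ _)); rewrite ler_nat.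
rewrite -(@card_in_imset _ _ (fun w => [set v; w])).
  apply: subset_leq_card; apply/subsetP => _ /imsetP[w + ->]; rewrite inE => wB.
  have [_ vw ne] := bad_atP wB.
  by rewrite inE mem_edges vw set21 eq_sym ne.
move=> w w'; rewrite !inE => /bad_atP[_ vw _] /bad_atP[_ vw' _] /setP/(_ w).
rewrite set22 !inE => /esym/orP[/eqP wv|/eqP //].
by rewrite wv adj_irr in vw.
Qed.
End Systems.

(** * Discarding edges with many incompatible centres *)

Section DegreeCounting.
Variables (R : realType) (V : finType) (G : sgraph V) (F : incompat_system G).
Variables (gamma nu mu : R).
Local Notation n := (#|V|%:R : R).

(* Exactly the pairs with few incompatible centres may both lie in a neighbourhood
   of a vertex that is chosen later. *)
Definition fine u w := #|[set v | bad_at F u v w]|%:R <= nu * n.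
Definition fine_adj u w := adj G u w && fine u w.

Lemma fine_adjC : symmetric fine_adj.
Proof.
move=> u w; rewrite /fine_adj adj_sym /fine; congr (_ && (_%:R <= _)).
by apply: eq_card => v; rewrite !inE bad_atC.
Qed.

Lemma bigminn_le (I : eqType) (r : seq I) (f : I -> nat) x i : i \in r ->
  (\big[minn/x]_(j <- r) f j <= f i)%N.
Proof.
elim: r => //= j r IH; rewrite inE big_cons geq_min => /orP[/eqP->|/IH->].
  by rewrite leqnn.
by rewrite orbT.
Qed.

Lemma min_degree_le v : (min_degree G <= degree G v)%N.
Proof. by apply: bigminn_le; rewrite mem_index_enum. Qed.

Lemma card_set_sum (P : pred V) : #|[set x | P x]|%:R = \sum_x (P x)%:R :> R.
Proof. by rewrite -sum1dep_card natr_sum big_mkcond; apply: eq_bigr => x _; case: (P x). Qed.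

Hypotheses (nu0 : 0 < nu) (mu0 : 0 < mu) (mu_gamma : mu <= nu * gamma / 2).
Hypothesis bF : bounded_system F (mu * n).

(** Double counting of the pairs (v, w) with [bad_at F u v w]: there are at most [mu * n] for each
    [v], but more than [nu * n] for each [w] that is not fine. *)
Lemma not_fine_few u : #|[set w | ~~ fine u w]|%:R <= gamma / 2 * n.
Proof.
have [n0|n0] := posnP #|V|.
  rewrite (_ : [set w | _] = set0) ?cards0 ?n0 ?mulr0 //.
  by apply/setP => w; have := card0_eq n0 w.
have n0' : 0 < n by rewrite ltr0n.
have : #|[set w | ~~ fine u w]|%:R * (nu * n) <= \sum_w #|[set v | bad_at F u v w]|%:R.
  rewrite card_set_sum mulr_suml; apply: ler_sum => w _.
  by rewrite /fine -ltNge; case: ltP => [/ltW|_]; rewrite ?mul1r ?mul0r.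
have -> : \sum_w #|[set v | bad_at F u v w]|%:R = \sum_v #|[set w | bad_at F u v w]|%:R :> R.
  under eq_bigr do rewrite card_set_sum.
  by rewrite exchange_big; apply: eq_bigr => v _; rewrite card_set_sum.
have : \sum_v #|[set w | bad_at F u v w]|%:R <= \sum_(v : V) mu * n.
  by apply: ler_sum => v _; apply: bad_at_bounded => //; rewrite mulr_ge0 // ltW.
rewrite sumr_const -[_ *+ _]mulr_natr => h2 h1.
rewrite -(ler_pM2r (mulr_gt0 nu0 n0')) (le_trans h1) // (le_trans h2) //.
have -> : gamma / 2 * n * (nu * n) = nu * gamma / 2 * n * n by ring.
by rewrite !ler_wpM2r.
Qed.

Lemma fine_adj_dense (delta : R) : (delta + gamma) * n <= (min_degree G)%:R ->
  dense fine_adj [set: V] (1 - delta - gamma / 2).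
Proof.
move=> hdeg v; rewrite cardsT.
have sub : [set x in [set: V] | ~~ fine_adj v x] \subset
    ~: [set x | adj G v x] :|: [set w | ~~ fine v w].
  by apply/subsetP => x; rewrite !inE /fine_adj negb_and.
have h1 : #|[set x in [set: V] | ~~ fine_adj v x]|%:R <=
    (n - (degree G v)%:R) + #|[set w | ~~ fine v w]|%:R.
  rewrite -natrB ?max_card // -natrD ler_nat (leq_trans (subset_leq_card sub)) //.
  by rewrite (leq_trans (leq_card_setU _ _)) // leq_add2r cardsCs setCK.
have h2 : (min_degree G)%:R <= (degree G v)%:R :> R by rewrite ler_nat min_degree_le.
by have := not_fine_few v; lra.
Qed.
End DegreeCounting.

Theorem theorem1p4 (R : realType) (gamma : R) (k : nat)
    (hgamma : 0 < gamma) (hk : (2 <= k)%N) :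
  exists2 mu : R, 0 < mu &
    exists N : nat, forall n : nat, (N <= n)%N ->
      forall (V : finType) (G : sgraph V) (F : incompat_system G),
        is_incompat_system n (k%:R / (k.+1)%:R + gamma) mu F ->
        exists H : sgraph V,
          [/\ subgraph H G, is_hamilton_power k H & compatible F H].
Proof.
have k0 : (0 < k)%N by apply: ltnW.
have K0 : 0 < k.+1%:R :> R by rewrite ltr0n.
(* Half of the degree surplus survives the passage to [fine_adj]; the cap brings [g] into the range
   of [closed_kpath_exists]. *)
pose g : R := Num.min (gamma / 2) (1 / (2 * k.+1%:R)).
have g0 : 0 < g by rewrite lt_min !divr_gt0 // mulr_gt0.
have gk : g <= 1 / (2 * k.+1%:R) by rewrite ge_min lexx orbT.
have gg : g <= gamma / 2 by rewrite ge_min lexx.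
have [nu nu0 [n0 closedP]] := closed_kpath_exists k0 g0 gk.
exists (Num.min nu (nu * gamma / 2)).
  by rewrite lt_min nu0 divr_gt0 // mulr_gt0.
set mu := Num.min _ _.
have mu0 : 0 < mu by rewrite lt_min nu0 divr_gt0 // mulr_gt0.
exists (n0 + (2 * k + 3))%N => n nN V G F [Vn hdeg bF].
rewrite -Vn in nN hdeg bF.
have V_gt0 : (0 < #|V|)%N by lia.
have [x0 _] := card_gt0P V_gt0.
pose adj' := fine_adj F nu; pose bad := bad_at F.
have mug : mu <= nu * gamma / 2 by rewrite ge_min lexx orbT.
have mun : mu <= nu by rewrite ge_min lexx.
have adjC : symmetric adj' by apply: fine_adjC.
have sys : sparse_system adj' bad (nu * #|V|%:R).
  split=> //.
  - exact: bad_atC.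
  - move=> u v; apply: le_trans (_ : mu * #|V|%:R <= _); last by rewrite ler_wpM2r.
    by apply: bad_at_bounded => //; rewrite mulr_ge0 // ltW.
  - by move=> u w /andP[].
have dens : dense adj' [set: V] (1 / k.+1%:R - g).
  move=> v; apply: le_trans (fine_adj_dense nu0 mu0 mug bF hdeg v) _.
  rewrite ler_wpM2r //.
  have -> : k%:R / k.+1%:R = 1 - 1 / k.+1%:R :> R.
    by rewrite -[k%:R](addrK 1) natr1 mulrBl divff // gt_eqF.
  by rewrite subKr lerB.
have [z [uz az cz]] := closedP V x0 adj' bad (leq_trans (leq_addr _ _) nN) sys dens.
have sz : (2 * k + 2 < size z)%N.
  have -> : size z = #|V| by rewrite -(card_uniqP uz); apply: eq_card => x; rewrite az.
  by lia.
pose H := power_graph uz az cz sz.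
have adjHE x y : adj H x y -> adj G x y.
  by move/(power_adj adjC) => /andP[].
exists H; split.
- apply/subsetP => _ /imsetP[[x y] + ->]; rewrite inE /= => xy.
  by rewrite mem_edges adjHE.
- exact: power_graph_hamilton.
(* Edges incompatible at [v] both contain [v], so they are {v, y} and {v, w} with y and w distinct
   neighbours of [v] in the power; [power_not_bad] excludes this. *)
move=> e e' eH e'H ne _ [v vF].
have [f [f' [_ _ _ fv E]]] := incompat_atP vF.
have vef (x : {set V}) : x \in [set e; e'] -> v \in x.
  have : v \in f :&: f' by rewrite fv set11.
  by rewrite inE E => /andP[vf vf']; rewrite !inE => /orP[] /eqP->.
have edge_at (x : {set V}) : v \in x -> x \in edges H -> exists2 y, adj H v y & x = [set v; y].
  move=> + /imsetP[[a b] + xE]; rewrite xE !inE /= => /orP[]/eqP-> ab; first by exists b.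
  by exists a; [rewrite power_rel_sym | rewrite setUC].
have [y vy eE] := edge_at e (vef e (set21 _ _)) eH.
have [w vw e'E] := edge_at e' (vef e' (set22 _ _)) e'H.
have yw : y != w by apply: contraNneq ne => yw; rewrite eE e'E yw.
have := power_not_bad vy vw yw.
by rewrite /bad /bad_at -eE -e'E vF.
Qed.
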